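(* Let $R$ be a Bézout domain which is not a field and let $S:=S(R)$ be the multiplicatively closed subset of $R$ generated by the units and all irreducible elements of $R$. The surjective lattice homomorphism $$\pi_S:\mathrm{pp}_R^1\rightarrow \mathrm{pp}_{R_S}^1$$ induced by restriction of scalars along the epimorphism $R\rightarrow R_S$ is such that for all $\varphi,\psi\in\mathrm{pp}_R^1$, $\pi_S(\varphi)=\pi_S(\psi)$ if and only if the interval $[\varphi\wedge\psi,\varphi+\psi]$ in $\mathrm{pp}_R^1$ has breadth $0$.
   Context: A Bézout domain is an integral domain whose finitely generated ideals are principal. $R_S$ denotes the localisation of $R$ at $S$. A pp-$1$-formula over $R$ is a formula $\exists \overline{y}\ \overline{y}A=xB$ with $A,B$ matrices over $R$; $\varphi(M)$ is its solution set in a module $M$. Formulae with the same solution set in every $R$-module are identified, and $\mathrm{pp}_R^1$ is the lattice of pp-$1$-formulae with $\psi\leq\varphi$ iff $\psi(M)\subseteq\varphi(M)$ for all $R$-modules $M$; meet is $\wedge$ and join is $+$. The map $\pi_S$ applies the localisation map $R\to R_S$ to the entries of the matrices defining a pp formula. An interval $[\psi,\varphi]$ has breadth $0$ (here including the one-point interval) iff there exist $\psi=\varphi_0\leq\varphi_1\leq\cdots\leq\varphi_n=\varphi$ such that each interval $[\varphi_i,\varphi_{i+1}]$ is totally ordered. *)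

(* Defs.v *)
From HB Require Import structures.
From mathcomp Require Import all_boot all_order all_algebra.
From mathcomp Require Import generic_quotient fraction boolp.

Set Implicit Arguments.
Unset Strict Implicit.
Unset Printing Implicit Defensive.

Import Order.TTheory GRing.Theory.

Local Open Scope quotient_scope.
Local Open Scope ring_scope.

Definition bezout_domain (R : idomainType) : Prop :=
  forall (n : nat) (a : 'I_n -> R), exists d : R, forall x : R,
    (exists c : 'I_n -> R, x = \sum_(i < n) c i * a i) <->
    (exists c : R, x = c * d).

Definition irreducible_elt (R : idomainType) (p : R) : Prop :=
  [/\ p != 0, p \isn't a GRing.unit
    & forall a b : R, p = a * b ->
        (a \is a GRing.unit) || (b \is a GRing.unit)].

Inductive unit_irr_generated (R : idomainType) : R -> Prop :=
  | UnitIrrUnit u : u \is a GRing.unit -> unit_irr_generated u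
  | UnitIrrIrr p : irreducible_elt p -> unit_irr_generated p
  | UnitIrrMul a b :
      unit_irr_generated a -> unit_irr_generated b -> unit_irr_generated (a * b).

Definition SR (R : idomainType) : {pred R} :=
  fun x => `[< unit_irr_generated x >].

Section SRTheory.
Variable R : idomainType.

Lemma SR_mulr_closed : mulr_closed (@SR R).
Proof.
split; first by apply/asboolP; apply: UnitIrrUnit; exact: unitr1.
by move=> x y /asboolP Sx /asboolP Sy; apply/asboolP; exact: UnitIrrMul.
Qed.

HB.instance Definition _ := GRing.isMulClosed.Build R (@SR R) SR_mulr_closed.

Lemma SR_neq0 (x : R) : x \in @SR R -> x != 0.
Proof.
move/asboolP; elim=> {x} [u|p []//|a b _ a0 _ b0]; last exact: mulf_neq0.
by apply: contraTneq => ->; rewrite unitr0.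
Qed.

End SRTheory.

(* The localisation of R at S, as the subring of all r / s with s in S of the
   fraction field.  Since r / 0 = 0 there, this is the usual localisation only
   for 0 \notin S, which holds for SR by SR_neq0. *)
Section Localisation.
Variables (R : idomainType) (S : GRing.MulClosed.type R).

Definition loc_pred : {pred {fraction R}} := fun x =>
  `[< exists r s : R, s \in S /\ x = FracField.tofrac r / FracField.tofrac s >].

Lemma loc_subring_closed : subring_closed loc_pred.
Proof.
split.
- by apply/asboolP; exists 1, 1; rewrite rpred1 divr1 tofrac1.
- move=> x y /asboolP[r [s [Ss ->]]] /asboolP[r' [s' [Ss' ->]]]; apply/asboolP.
  have [->|s0] := eqVneq s 0.
    exists (- r'), s'; split=> //.
    by rewrite tofrac0 invr0 mulr0 sub0r tofracN mulNr.
  have [->|s'0] := eqVneq s' 0.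
    by exists r, s; split=> //; rewrite tofrac0 invr0 mulr0 subr0.
  exists (r * s' - r' * s), (s * s'); split; first exact: rpredM.
  by rewrite tofracB !tofracM -mulNr addf_div ?tofrac_eq0 // mulNr.
- move=> x y /asboolP[r [s [Ss ->]]] /asboolP[r' [s' [Ss' ->]]]; apply/asboolP.
  exists (r * r'), (s * s'); split; first exact: rpredM.
  by rewrite !tofracM mulf_div.
Qed.

HB.instance Definition _ :=
  GRing.isSubringClosed.Build {fraction R} loc_pred loc_subring_closed.

Record localisation := Loc { loc_val : {fraction R}; _ : loc_val \in loc_pred }.

HB.instance Definition _ := [isSub for loc_val].
HB.instance Definition _ := [Choice of localisation by <:].
HB.instance Definition _ := [SubChoice_isSubComNzRing of localisation by <:].

Fact loc_map_subproof (r : R) : FracField.tofrac r \in loc_pred.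
Proof. by apply/asboolP; exists r, 1; rewrite rpred1 tofrac1 divr1. Qed.

Definition loc_map (r : R) : localisation := Loc (loc_map_subproof r).

Fact loc_map_zmod_morphism : zmod_morphism loc_map.
Proof. by move=> x y; apply: val_inj; rewrite raddfB /= tofracB. Qed.

HB.instance Definition _ :=
  GRing.isZmodMorphism.Build R localisation loc_map loc_map_zmod_morphism.

Fact loc_map_monoid_morphism : monoid_morphism loc_map.
Proof.
by split=> [|x y]; apply: val_inj; rewrite ?rmorphM ?rmorph1 /= ?tofracM ?tofrac1.
Qed.

HB.instance Definition _ :=
  GRing.isMonoidMorphism.Build R localisation loc_map loc_map_monoid_morphism.

End Localisation.

(* The pp-1-formula  exists y, y A = x B.  The rings are commutative, so left
   and right modules are the same and the j-th equation of  y A = x B  is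
   \sum_i A i j *: y i = B 0 j *: x. *)
Record ppf (R : comNzRingType) := PPF {
  pp_nvar : nat;
  pp_neqn : nat;
  pp_A : 'M[R]_(pp_nvar, pp_neqn);
  pp_B : 'rV[R]_pp_neqn }.

Section PPFormulas.
Variable R : comNzRingType.
Implicit Types (f g h : ppf R) (M : lmodType R).

HB.instance Definition _ := gen_eqMixin (ppf R).
HB.instance Definition _ := gen_choiceMixin (ppf R).

Definition ppsol f M (x : M) : Prop :=
  exists y : 'I_(pp_nvar f) -> M, forall j,
    \sum_i pp_A f i j *: y i = pp_B f 0 j *: x.

Definition pple f g : Prop := forall M (x : M), ppsol f x -> ppsol g x.

Definition ppequiv : rel (ppf R) := fun f g => `[< pple f g /\ pple g f >].

Fact ppequiv_refl : reflexive ppequiv.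
Proof. by move=> f; apply/asboolP; split. Qed.

Fact ppequiv_sym : symmetric ppequiv.
Proof. by move=> f g; apply/asboolP/asboolP=> -[]. Qed.

Fact ppequiv_trans : transitive ppequiv.
Proof.
move=> g f h /asboolP[fg gf] /asboolP[gh hg]; apply/asboolP.
by split=> M x; [move/fg/gh|move/hg/gf].
Qed.

Canonical ppequiv_equiv := EquivRel ppequiv ppequiv_refl ppequiv_sym ppequiv_trans.

Let mx0E m n i j : (0 : 'M[R]_(m, n)) i j = 0. Proof. by rewrite mxE. Qed.
Let mxNE m n (A : 'M[R]_(m, n)) i j : (- A) i j = - A i j. Proof. by rewrite mxE. Qed.

(* y A = x B and z C = x D *)
Definition ppf_meet f g : ppf R :=
  PPF (block_mx (pp_A f) 0 0 (pp_A g)) (row_mx (pp_B f) (pp_B g)).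

(* y A = u B and z C = (x - u) D, in the unknowns u, y, z *)
Definition ppf_join f g : ppf R :=
  PPF (col_mx (row_mx (- pp_B f) (pp_B g)) (block_mx (pp_A f) 0 0 (pp_A g)))
      (row_mx 0 (pp_B g)).

Lemma ppsol_meet f g M (x : M) : ppsol (ppf_meet f g) x <-> ppsol f x /\ ppsol g x.
Proof.
split=> [[y yP]|[[y yP] [z zP]]].
- split; [exists (fun i => y (lshift _ i))|exists (fun i => y (rshift _ i))] => j.
  + move: (yP (lshift _ j)); rewrite /= big_split_ord /= row_mxEl.
    rewrite [X in _ + X]big1 ?addr0 => [<-|i _]; last first.
      by rewrite block_mxEdl mxE scale0r.
    by apply: eq_bigr => i _; rewrite block_mxEul.
  + move: (yP (rshift _ j)); rewrite /= big_split_ord /= row_mxEr.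
    rewrite [X in X + _]big1 ?add0r => [<-|i _]; last first.
      by rewrite block_mxEur mxE scale0r.
    by apply: eq_bigr => i _; rewrite block_mxEdr.
- exists (fun i => match split i with inl k => y k | inr k => z k end) => j.
  rewrite /= big_split_ord /= -[j]splitK; case: (split j) => k /=.
  + rewrite row_mxEl -yP [X in _ + X]big1 ?addr0 => [|i _]; last first.
      by rewrite block_mxEdl mxE scale0r.
    by apply: eq_bigr => i _; rewrite block_mxEul (unsplitK (inl _ i)).
  + rewrite row_mxEr -zP [X in X + _]big1 ?add0r => [|i _]; last first.
      by rewrite block_mxEur mxE scale0r.
    by apply: eq_bigr => i _; rewrite block_mxEdr (unsplitK (inr _ i)).
Qed.

Lemma ppsol_join f g M (x : M) :
  ppsol (ppf_join f g) x <-> exists u v : M, [/\ x = u + v, ppsol f u & ppsol g v].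
Proof.
split=> [[y yP]|[u [v [-> [y yP] [z zP]]]]].
- pose u := y (lshift _ ord0).
  exists u, (x - u); split; first by rewrite addrC subrK.
  + exists (fun i => y (rshift 1 (lshift _ i))) => j.
    move: (yP (lshift _ j)); rewrite /= !big_split_ord /= big_ord1 row_mxEl mx0E.
    rewrite scale0r [X in _ + (_ + X)]big1 ?addr0 => [|i _]; last first.
      by rewrite col_mxEd block_mxEdl mx0E scale0r.
    rewrite col_mxEu row_mxEl mxNE scaleNr -/u => /eqP.
    rewrite addrC subr_eq0 => /eqP <-.
    by apply: eq_bigr => i _; rewrite col_mxEd block_mxEul.
  + exists (fun i => y (rshift 1 (rshift _ i))) => j.
    move: (yP (rshift _ j)); rewrite /= !big_split_ord /= big_ord1 row_mxEr.
    rewrite [X in _ + (X + _)]big1 ?add0r => [|i _]; last first.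
      by rewrite col_mxEd block_mxEur mx0E scale0r.
    rewrite col_mxEu row_mxEr -/u scalerBr => <-; rewrite [RHS]addrAC subrr add0r.
    by apply: eq_bigr => i _; rewrite col_mxEd block_mxEdr.
- exists (fun i => match split i with inl _ => u | inr k =>
            match split k with inl k => y k | inr k => z k end end) => j.
  rewrite /= !big_split_ord /= big_ord1 (unsplitK (inl _ _)).
  rewrite -[j]splitK; case: (split j) => k /=.
  + rewrite row_mxEl mx0E scale0r col_mxEu row_mxEl mxNE scaleNr -yP.
    rewrite [X in _ + (_ + X)]big1 ?addr0 => [|i _]; last first.
      by rewrite col_mxEd block_mxEdl mx0E scale0r.
    rewrite addrC; apply/eqP; rewrite subr_eq0; apply/eqP.
    apply: eq_bigr => i _.
    by rewrite col_mxEd block_mxEul (unsplitK (inr _ _)) (unsplitK (inl _ i)).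
  + rewrite row_mxEr col_mxEu row_mxEr scalerDr -zP; congr (_ + _).
    rewrite [X in X + _]big1 ?add0r => [|i _]; last first.
      by rewrite col_mxEd block_mxEur mx0E scale0r.
    apply: eq_bigr => i _.
    by rewrite col_mxEd block_mxEdr (unsplitK (inr _ _)) (unsplitK (inr _ i)).
Qed.

Lemma ppsol0 f M : ppsol f (0 : M).
Proof.
by exists (fun=> 0) => j; rewrite scaler0 big1 // => i _; rewrite scaler0.
Qed.

Lemma ppsolD f M (x y : M) : ppsol f x -> ppsol f y -> ppsol f (x + y).
Proof.
move=> [u uP] [v vP]; exists (fun i => u i + v i) => j.
rewrite scalerDr -uP -vP -big_split /=.
by apply: eq_bigr => i _; rewrite scalerDr.
Qed.

End PPFormulas.

Definition pp1 (R : comNzRingType) : Type := {eq_quot @ppequiv R}.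

Fact pp_display : Order.disp_t. Proof. exact: Order.Disp tt tt. Qed.

Section PPLattice.
Variable R : comNzRingType.
Implicit Types (p q r : pp1 R) (f g : ppf R).

HB.instance Definition _ := Choice.on (pp1 R).
HB.instance Definition _ := EqQuotient.on (pp1 R).

Lemma pp1_eqP f g : (\pi_(pp1 R) f = \pi_(pp1 R) g) <-> pple f g /\ pple g f.
Proof.
by split=> [/eqmodP/asboolP//|fg]; apply/eqmodP/asboolP.
Qed.

Definition pp1_le : rel (pp1 R) := fun p q => `[< pple (repr p) (repr q) >].
Definition pp1_meet p q : pp1 R := \pi_(pp1 R) (ppf_meet (repr p) (repr q)).
Definition pp1_join p q : pp1 R := \pi_(pp1 R) (ppf_join (repr p) (repr q)).

Lemma repr_piP f : pple f (repr (\pi_(pp1 R) f)) /\ pple (repr (\pi_(pp1 R) f)) f.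
Proof. by apply/pp1_eqP; rewrite reprK. Qed.

Fact pp1_le_refl : reflexive pp1_le.
Proof. by move=> p; apply/asboolP. Qed.

Fact pp1_le_anti : antisymmetric pp1_le.
Proof.
move=> p q /andP[/asboolP pq /asboolP qp].
by rewrite -[p]reprK -[q]reprK; apply/pp1_eqP.
Qed.

Fact pp1_le_trans : transitive pp1_le.
Proof.
by move=> q p r /asboolP pq /asboolP qr; apply/asboolP => M x /pq/qr.
Qed.

HB.instance Definition _ := Order.Le_isPOrder.Build pp_display (pp1 R)
  pp1_le_refl pp1_le_anti pp1_le_trans.

Fact pp1_lexI p q r : pp1_le p (pp1_meet q r) = pp1_le p q && pp1_le p r.
Proof.
have [le1 le2] := repr_piP (ppf_meet (repr q) (repr r)).
apply/asboolP/andP=> [pqr|[/asboolP pq /asboolP pr] M x px].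
  by split; apply/asboolP => M x /pqr/le2/ppsol_meet[].
by apply: le1; apply/ppsol_meet; split; [exact: pq|exact: pr].
Qed.

Fact pp1_leUx p q r : pp1_le (pp1_join p q) r = pp1_le p r && pp1_le q r.
Proof.
have [le1 le2] := repr_piP (ppf_join (repr p) (repr q)).
apply/asboolP/andP=> [pqr|[/asboolP pr /asboolP qr] M x].
  split; apply/asboolP => M x xp; apply: pqr; apply: le1; apply/ppsol_join.
    by exists x, 0; split; rewrite ?addr0 //; exact: ppsol0.
  by exists 0, x; split; rewrite ?add0r //; exact: ppsol0.
move=> /le2/ppsol_join[u [v [-> /pr ru /qr rv]]]; exact: ppsolD.
Qed.

HB.instance Definition _ := Order.POrder_MeetJoin_isLattice.Build pp_display
  (pp1 R) pp1_lexI pp1_leUx.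

Lemma pp1_leP f g : reflect (pple f g) (\pi_(pp1 R) f <= \pi_(pp1 R) g)%O.
Proof.
have [f1 f2] := repr_piP f; have [g1 g2] := repr_piP g.
apply: (iffP (asboolP _)) => le M x; first by move/f1/le/g2.
by move/f2/le/g1.
Qed.

End PPLattice.

Section Restriction.
Variables (R R' : comNzRingType) (h : {rmorphism R -> R'}).

Definition restr (M : lmodType R') : Type := M.

Section RestrictionModule.
Variable M : lmodType R'.

HB.instance Definition _ := GRing.Zmodule.on (restr M).

Let rscale (a : R) (x : restr M) : restr M := h a *: (x : M).

Fact restr_scalerA a b v : rscale a (rscale b v) = rscale (a * b) v.
Proof. by rewrite /rscale scalerA rmorphM. Qed.

Fact restr_scale1r : left_id 1 rscale.
Proof. by move=> v; rewrite /rscale rmorph1 scale1r. Qed.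

Fact restr_scalerDr : right_distributive rscale +%R.
Proof. by move=> a u v; rewrite /rscale -scalerDr. Qed.

Fact restr_scalerDl v : {morph rscale^~ v : a b / a + b}.
Proof. by move=> a b; rewrite /rscale rmorphD scalerDl. Qed.

HB.instance Definition _ := GRing.Zmodule_isLmodule.Build R (restr M)
  restr_scalerA restr_scale1r restr_scalerDr restr_scalerDl.

End RestrictionModule.

Definition ppf_map (f : ppf R) : ppf R' := PPF (map_mx h (pp_A f)) (map_mx h (pp_B f)).

Lemma ppsol_map (f : ppf R) (M : lmodType R') (x : M) :
  ppsol (ppf_map f) x <-> ppsol f (x : restr M).
Proof.
split=> -[y yP]; exists y => j; have := yP j; rewrite /= mxE => eqj.
  by rewrite -[RHS]eqj; apply: eq_bigr => i _; rewrite mxE.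
by rewrite -[RHS]eqj; apply: eq_bigr => i _; rewrite mxE.
Qed.

Definition pp1_map (p : pp1 R) : pp1 R' := \pi_(pp1 R') (ppf_map (repr p)).

Lemma pp1_map_pi (f : ppf R) : pp1_map (\pi_(pp1 R) f) = \pi_(pp1 R') (ppf_map f).
Proof.
have [f1 f2] := repr_piP f.
by apply/pp1_eqP; split=> M x /ppsol_map fx; apply/ppsol_map; [exact: f2|exact: f1].
Qed.

End Restriction.

Definition interval_total (d : Order.disp_t) (L : latticeType d) (a b : L) : Prop :=
  forall x y : L, (a <= x <= b)%O -> (a <= y <= b)%O -> (x <= y)%O || (y <= x)%O.

(* n = 0 gives the one-point interval *)
Definition breadth0 (d : Order.disp_t) (L : latticeType d) (a b : L) : Prop :=
  exists (n : nat) (c : nat -> L),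
    [/\ c 0%N = a, c n = b
      & forall i, (i < n)%N -> (c i <= c i.+1)%O /\ interval_total (c i) (c i.+1)].

Definition piS (R : idomainType) : pp1 R -> pp1 (localisation (@SR R)) :=
  pp1_map (@loc_map R (@SR R)).

(* Main.v *)
Require Import Defs.
From HB Require Import structures.
From mathcomp Require Import all_boot all_order all_algebra.
From mathcomp Require Import generic_quotient ring_quotient fraction boolp.
From mathcomp Require Import ring.

(** Write [box_pp a b] for the formula a | x and b x = 0, and [cobox_pp c d] for
    (c | x) + (d x = 0). Over a Bezout domain every pp-1-formula is a finite sum
    of boxes ([pp1_box_sum]): after localising, a presentation matrix can be
    diagonalized, and the local diagonalizations are glued by a partition of
    unity. A box is freely realized by a cyclic module, in which a decomposition
    x = u + v can be made proportional to x ([cls_join]). Hence the lattice is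
    distributive ([pp1_meetUl]), every formula is also a finite meet of coboxes
    ([pp1_cobox_meet]), and the relation [box_pp a b <= cobox_pp c d] becomes a
    comaximality condition ([box_le_cobox]).

    Let (q : s) be the formula s x in q. Clearing denominators in a cyclic module
    over the localisation gives [piS_le]: the image of p is below the image of q
    iff p <= (q : s) for some s in S. Both directions then compare intervals of
    breadth 0 with the intervals [q, (q : s)].

    - Each [q, (q : s)] has breadth 0 ([breadth0_colon]). For a product s = s1 s2
      such intervals are concatenated, so let s = p be irreducible. Then
      q |-> (q : p) is a lattice endomorphism, and in a modular lattice intervals
      of breadth 0 are stable under meets and joins. It is therefore enough to
      treat a | x and b x = 0, where the relevant intervals are chains because
      R localised at p is a valuation domain with maximal ideal generated by p.

    - A totally ordered interval [q, p] satisfies p <= (q : s) for some s in S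
      ([interval_total_colon]). The normal forms reduce this to a box against a
      cobox. Their difference is governed by one element e, which multiplies the
      box into the cobox; if e were neither a unit nor irreducible, a
      factorization of e would produce two incomparable formulae in the interval
      ([box_cobox_separation]). *)

Set Implicit Arguments.
Unset Strict Implicit.
Unset Printing Implicit Defensive.

Import Order.TTheory GRing.Theory.

Local Open Scope quotient_scope.
Local Open Scope ring_scope.

(** * Arithmetic of Bezout domains *)

(** When both elements vanish the cofactors are still chosen comaximal. *)
Lemma bezout_gcd (R : idomainType) (bezR : bezout_domain R) (a b : R) :
  exists g a' b' r t : R, [/\ a = g * a', b = g * b' & r * a' + t * b' = 1].
Proof.
have [d dP] := bezR 2 (fun i => if i == ord0 then a else b).
have sumE (c : 'I_2 -> R) :
  \sum_(i < 2) c i * (if i == ord0 then a else b) = c ord0 * a + c (lift ord0 ord0) * b.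
  by rewrite big_ord_recl big_ord1.
have [a' ea] : exists c, a = c * d.
  by apply/dP; exists (fun i => (i == ord0)%:R); rewrite sumE /= mul1r mul0r addr0.
have [b' eb] : exists c, b = c * d.
  by apply/dP; exists (fun i => (i != ord0)%:R); rewrite sumE /= mul1r mul0r add0r.
have [c] : exists c : 'I_2 -> R,
    d = \sum_(i < 2) c i * (if i == ord0 then a else b).
  by apply/dP; exists 1; rewrite mul1r.
rewrite sumE => ed.
have [d0|dn0] := eqVneq d 0.
  exists 0, 1, 1, 1, 0; split; last by ring.
    by rewrite ea d0; ring.
  by rewrite eb d0; ring.
exists d, a', b', (c ord0), (c (lift ord0 ord0)).
split; first by rewrite mulrC.
  by rewrite mulrC.
by apply: (mulIf dn0); rewrite [in RHS]ed ea eb; ring.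
Qed.

(** The content of a finite nonempty family; when the family vanishes, the
    cofactors are taken to be [1], so that they are comaximal in every case. *)
Lemma bezout_content (R : idomainType) (bezR : bezout_domain R)
    (T : finType) (t0 : T) (f : T -> R) :
  exists (g : R) (f' r : T -> R),
    (forall t, f t = g * f' t) /\ \sum_t r t * f' t = 1.
Proof.
have [d dP] := bezR #|T| (f \o enum_val).
have sumE (c : T -> R) :
    \sum_(i < #|T|) c (enum_val i) * f (enum_val i) = \sum_t c t * f t.
  by rewrite -(big_enum_val (fun t => c t * f t)).
have exf' t : {c | f t = c * d}.
  apply/cid/dP; exists (fun i => (i == enum_rank t)%:R).
  rewrite (bigD1 (enum_rank t)) //= eqxx mul1r enum_rankK big1 ?addr0 // => i ne.
  by rewrite (negPf ne) mul0r.
have [d0|dn0] := eqVneq d 0.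
  exists 0, (fun=> 1), (fun t => (t == t0)%:R); split=> [t|].
    by case: (exf' t) => c ->; rewrite d0 mulr0 mul0r.
  by rewrite (bigD1 t0) //= eqxx mul1r big1 ?addr0 // => t /negPf->; rewrite mul0r.
have [c] : exists c : 'I_#|T| -> R, d = \sum_i c i * f (enum_val i).
  by apply/dP; exists 1; rewrite mul1r.
move=> ed; exists d, (fun t => sval (exf' t)), (fun t => c (enum_rank t)).
split=> [t|]; first by case: (exf' t) => c' /= ->; rewrite mulrC.
apply: (mulfI dn0); rewrite mulr1 [in RHS]ed big_distrr /=.
have -> : \sum_i c i * f (enum_val i) = \sum_t c (enum_rank t) * f t.
  rewrite -(sumE (c \o enum_rank)) /=.
  by apply: eq_bigr => i _; rewrite enum_valK.
apply: eq_bigr => t _.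
by case: (exf' t) => c' /= ->; rewrite mulrCA [d * _]mulrC.
Qed.

(** A gcd of [p] and [u] is a divisor of [p], hence a unit unless [p] divides [u]:
    an irreducible element generates a maximal ideal. *)
Lemma irreducible_coprime (R : idomainType) (bezR : bezout_domain R) (p u : R) :
  irreducible_elt p -> ~ (exists v, u = p * v) ->
  exists r t : R, r * u + t * p = 1.
Proof.
move=> [p0 pnu pP] npu; have [g [p' [u' [r [t [ep eu e1]]]]]] := bezout_gcd bezR p u.
case/orP: (pP _ _ ep) => [ug|up'].
  exists (t * g^-1), (r * g^-1).
  by rewrite -e1 ep eu !mulrA !divrK // addrC.
by case: npu; exists (p'^-1 * u'); rewrite eu ep -mulrA mulVKr.
Qed.

(** Squares of generators of the unit ideal still generate it. The ideal [I] and
    the congruence modulo [I], in place of an equality, are what the induction on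
    the number of generators needs. *)
Lemma unit_ideal_squares (R : comNzRingType) (T : Type) (l : seq T)
    (u r : T -> R) (I : R -> Prop) :
  (forall x y, I x -> I y -> I (x + y)) -> (forall x y, I y -> I (x * y)) ->
  (forall t, I (u t ^+ 2)) -> I (1 - \sum_(t <- l) r t * u t) -> I 1.
Proof.
elim: l I => [|t l IH] I ID IM Iu; first by rewrite big_nil subr0.
rewrite big_cons; set w := \sum_(_ <- _) _ => It.
(* [v ^+ 2] lies in [I], so the induction hypothesis applies first to the
   ideal of all [x] with [x * v] in [I], and then to [I] itself. *)
pose v := 1 - w.
have Iv2 : I (v * v).
  have -> : v * v = (v + r t * u t) * (1 - (r t * u t + w)) + r t ^+ 2 * u t ^+ 2.
    by rewrite /v; ring.
  by apply: ID; apply: IM.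
have Iv : I (1 * v).
  apply: (IH (fun x => I (x * v))) => // [x y Ix Iy|x y Iy|s].
  - by rewrite mulrDl; apply: ID.
  - by rewrite -mulrA; apply: IM.
  - by rewrite mulrC; apply: IM.
by apply: (IH I) => //; rewrite mul1r in Iv.
Qed.

(** * Solution sets *)

Definition psol (R : comNzRingType) (p : pp1 R) (M : lmodType R) (x : M) : Prop :=
  ppsol (repr p) x.
Arguments psol {R} p {M} x.

Section SolutionSets.
Variable R : comNzRingType.
Implicit Types (p q : pp1 R) (M N : lmodType R).

Lemma psol_pi (f : ppf R) M (x : M) : psol (\pi_(pp1 R) f) x <-> ppsol f x.
Proof. by have [le1 le2] := repr_piP f; split=> [/le2|/le1]. Qed.

Lemma pp1_psolP p q :
  (p <= q)%O <-> (forall M (x : M), psol p x -> psol q x).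
Proof. by split=> [/asboolP|pq]; last exact/asboolP. Qed.

Lemma psol_le p q M (x : M) : (p <= q)%O -> psol p x -> psol q x.
Proof. by move/pp1_psolP; apply. Qed.

Lemma pp1_psol_eq p q : (forall M (x : M), psol p x <-> psol q x) -> p = q.
Proof. by move=> pq; apply/le_anti/andP; split; apply/pp1_psolP => M x /pq. Qed.

Lemma psol_meet p q M (x : M) : psol (p `&` q)%O x <-> psol p x /\ psol q x.
Proof. by rewrite psol_pi; apply: ppsol_meet. Qed.

Lemma psol_join p q M (x : M) :
  psol (p `|` q)%O x <-> exists u v : M, [/\ x = u + v, psol p u & psol q v].
Proof. by rewrite psol_pi; apply: ppsol_join. Qed.

Lemma psol0 p M : psol p (0 : M). Proof. exact: ppsol0. Qed.

Lemma psolD p M (x y : M) : psol p x -> psol p y -> psol p (x + y).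
Proof. exact: ppsolD. Qed.

Lemma psol_morph p M N (h : M -> N) (x : M) :
  {morph h : u v / u + v} -> (forall r u, h (r *: u) = r *: h u) ->
  psol p x -> psol p (h x).
Proof.
move=> hD hZ [y yP]; exists (h \o y) => j.
have h0 : h 0 = 0 by rewrite -(scale0r (0 : M)) hZ scale0r.
by rewrite -hZ -yP (big_morph h hD h0); apply: eq_bigr => i _; rewrite hZ.
Qed.

Lemma psolZ p M (r : R) (x : M) : psol p x -> psol p (r *: x).
Proof.
apply: (@psol_morph p M M ( *:%R r)) => [u v|s u]; first exact: scalerDr.
by rewrite !scalerA mulrC.
Qed.

(** The divisibility formula a | x and the annihilation formula b x = 0 *)
Definition dvd_pp (a : R) : pp1 R := \pi_(pp1 R) (@PPF R 1 1 a%:M 1%:M).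
Definition ann_pp (b : R) : pp1 R := \pi_(pp1 R) (@PPF R 0 1 0 b%:M).

Lemma psol_dvd a M (x : M) : psol (dvd_pp a) x <-> exists y, x = a *: y.
Proof.
rewrite psol_pi; split=> [[y /(_ ord0)]|[y ->]] /=.
  by rewrite big_ord1 !mxE /= scale1r => <-; exists (y ord0).
by exists (fun=> y) => j; rewrite ord1 /= big_ord1 !mxE /= scale1r.
Qed.

Lemma psol_ann b M (x : M) : psol (ann_pp b) x <-> b *: x = 0.
Proof.
rewrite psol_pi; split=> [[y /(_ ord0)]|bx] /=.
  by rewrite big_ord0 mxE /=.
by exists (fun=> 0) => j; rewrite ord1 /= big_ord0 mxE /= mulr1n bx.
Qed.

(** The basic formulae: a cyclic module [R / a b R] pointed at [a] freely
    realizes [box_pp a b], and [cobox_pp] is its dual. *)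
Definition box_pp (a b : R) : pp1 R := (dvd_pp a `&` ann_pp b)%O.
Definition cobox_pp (c d : R) : pp1 R := (dvd_pp c `|` ann_pp d)%O.

Lemma psol_box a b M (x : M) :
  psol (box_pp a b) x <-> exists y, x = a *: y /\ b *: x = 0.
Proof.
rewrite psol_meet psol_dvd psol_ann; split; first by case=> -[y ->] b0; exists y.
by case=> y [-> b0]; split=> //; exists y.
Qed.

Lemma psol_cobox c d M (x : M) :
  psol (cobox_pp c d) x <-> exists y z, x = c *: y + z /\ d *: z = 0.
Proof.
rewrite psol_join; split=> [[u [v [-> /psol_dvd[y ->] /psol_ann dv]]]|].
  by exists y, v.
move=> [y [z [-> dz]]]; exists (c *: y), z; split=> //; last exact/psol_ann.
by apply/psol_dvd; exists y.
Qed.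

End SolutionSets.

(** * Cyclic modules *)

Section CyclicModule.
Variables (R : comNzRingType) (m : R).

Definition principal : {pred R} := fun x => `[< exists k, x = m * k >].

Fact principal_zmod_closed : zmod_closed principal.
Proof.
split=> [|_ _ /asboolP[k ->] /asboolP[l ->]]; apply/asboolP.
  by exists 0; rewrite mulr0.
by exists (k - l); rewrite mulrBr.
Qed.

HB.instance Definition _ := GRing.isZmodClosed.Build R principal principal_zmod_closed.

Definition cyclic : Type := Quotient.quot principal.
HB.instance Definition _ := GRing.Zmodule.on cyclic.

Definition cls (x : R) : cyclic := \pi_(Quotient.quot principal) x.

Lemma cls_eq x y : cls x = cls y <-> exists k, x = y + m * k.
Proof.
rewrite /cls; split=> [/eqP|[k e]].
  by rewrite -Quotient.idealrBE => /asboolP[k e]; exists k; rewrite -e; ring.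
by apply/eqP; rewrite -Quotient.idealrBE; apply/asboolP; exists k; rewrite e; ring.
Qed.

Lemma cls_eq0 x : cls x = 0 <-> exists k, x = m * k.
Proof.
rewrite -(raddf0 (\pi_(Quotient.quot principal))).
by rewrite -[_ 0]/(cls 0) cls_eq; split=> -[k ->]; exists k; rewrite add0r.
Qed.

Lemma clsP (z : cyclic) : exists x, z = cls x.
Proof. by exists (repr z); rewrite /cls reprK. Qed.

Lemma clsD x y : cls (x + y) = cls x + cls y.
Proof. exact: raddfD. Qed.

Definition cyclic_scale (r : R) (z : cyclic) : cyclic := cls (r * repr z).

Lemma cyclic_scaleE r x : cyclic_scale r (cls x) = cls (r * x).
Proof.
have [k e] : exists k, repr (cls x) = x + m * k.
  by apply/cls_eq; rewrite /cls reprK.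
by apply/cls_eq; exists (r * k); rewrite e; ring.
Qed.

Fact cyclic_scaleA a b v : cyclic_scale a (cyclic_scale b v) = cyclic_scale (a * b) v.
Proof. by have [x ->] := clsP v; rewrite !cyclic_scaleE mulrA. Qed.

Fact cyclic_scale1 : left_id 1 cyclic_scale.
Proof. by move=> v; have [x ->] := clsP v; rewrite cyclic_scaleE mul1r. Qed.

Fact cyclic_scaleDr : right_distributive cyclic_scale +%R.
Proof.
move=> a u v; have [x ->] := clsP u; have [y ->] := clsP v.
by rewrite -clsD !cyclic_scaleE -clsD mulrDr.
Qed.

Fact cyclic_scaleDl v : {morph cyclic_scale^~ v : a b / a + b}.
Proof.
by move=> a b; have [x ->] := clsP v; rewrite !cyclic_scaleE -clsD mulrDl.
Qed.

HB.instance Definition _ := GRing.Zmodule_isLmodule.Build R cyclic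
  cyclic_scaleA cyclic_scale1 cyclic_scaleDr cyclic_scaleDl.

Lemma clsZ r x : cls (r * x) = r *: cls x.
Proof. by rewrite -cyclic_scaleE. Qed.

Lemma cls_sum (I : Type) (l : seq I) (f : I -> R) :
  cls (\sum_(i <- l) f i) = \sum_(i <- l) cls (f i).
Proof. by apply: (big_morph cls clsD); apply: raddf0. Qed.

(** The homomorphism from R / m R to [M] that sends the generator to [y] *)
Lemma psol_cls (p : pp1 R) (M : lmodType R) (x : R) (y : M) :
  psol p (cls x) -> m *: y = 0 -> psol p (x *: y).
Proof.
move=> px my; pose h (z : cyclic) := repr z *: y.
have hE z : h (cls z) = z *: y.
  have [k e] : exists k, repr (cls z) = z + m * k.
    by apply/cls_eq; rewrite /cls reprK.
  by rewrite /h e scalerDl mulrC -scalerA my scaler0 addr0.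
rewrite -hE; apply: psol_morph px => [u v|r u].
  by have [a ->] := clsP u; have [b ->] := clsP v; rewrite -clsD !hE scalerDl.
by have [a ->] := clsP u; rewrite -clsZ !hE scalerA.
Qed.

End CyclicModule.

(** Free realization of a box: it holds at [a] in R / a b R, and every other
    solution is the image of that one. *)
Lemma box_le_psol (R : comNzRingType) (p : pp1 R) (a b : R) :
  (box_pp a b <= p)%O <-> psol p (cls (a * b) a).
Proof.
split=> [/pp1_psolP|pa]; last first.
  apply/pp1_psolP => M x /psol_box[y [-> b0]]; apply: psol_cls pa _.
  by rewrite mulrC -scalerA.
apply; apply/psol_box; exists (cls _ 1); rewrite -clsZ mulr1; split=> //.
by rewrite -clsZ; apply/cls_eq0; exists 1; rewrite mulr1 mulrC.
Qed.

(** * Sums of basic formulae *)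

Section BoxSum.
Variable R : comNzRingType.

Inductive box_sum : pp1 R -> Prop :=
  | BoxSumBox a b : box_sum (box_pp a b)
  | BoxSumJoin p q : box_sum p -> box_sum q -> box_sum (p `|` q)%O.

Lemma box_sum_lub (T : eqType) (l : seq T) (q : T -> pp1 R) :
  (forall t, box_sum (q t)) ->
  exists Q, [/\ box_sum Q, forall t, t \in l -> (q t <= Q)%O
    & forall p, (forall t, (q t <= p)%O) -> (Q <= p)%O].
Proof.
move=> sq; elim: l => [|t l [Q [sQ qQ Qle]]].
  exists (box_pp 1 1); split=> // [|p _]; first exact: BoxSumBox.
  apply/pp1_psolP => M x /psol_box[y [_]]; rewrite scale1r => ->; exact: psol0.
exists (q t `|` Q)%O; split=> [|s|p qp].
- exact: BoxSumJoin.
- rewrite in_cons => /orP[/eqP->|/qQ le]; first exact: leUl.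
  exact: le_trans le (leUr _ _).
- by rewrite leUx qp Qle.
Qed.

(** The formula {v w | w P = 0}: the solutions of a pp formula are written as
    linear forms evaluated on the solutions of a homogeneous system, so that
    row and column operations act on all unknowns alike. *)
Definition lin_pp k m (P : 'I_k -> 'I_m -> R) (v : 'I_k -> R) : pp1 R :=
  \pi_(pp1 R) (@PPF R k (m + 1)
    (row_mx (\matrix_(i, j) P i j) (\col_i v i)) (row_mx 0 1%:M)).

Lemma psol_lin k m (P : 'I_k -> 'I_m -> R) v (M : lmodType R) (x : M) :
  psol (lin_pp P v) x <-> exists w : 'I_k -> M,
    (forall j, \sum_i P i j *: w i = 0) /\ x = \sum_i v i *: w i.
Proof.
rewrite psol_pi; split=> [[w wP]|[w [wP ->]]]; exists w.
  split=> [j|].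
    have := wP (lshift _ j); rewrite /= row_mxEl mxE scale0r => e.
    by rewrite -[RHS]e; apply: eq_bigr => i _; rewrite row_mxEl mxE.
  have := wP (rshift _ ord0); rewrite /= row_mxEr mxE eqxx scale1r => e.
  by rewrite -[LHS]e; apply: eq_bigr => i _; rewrite row_mxEr mxE.
move=> j; rewrite /= -[j]splitK; case: (split j) => i /=.
  rewrite row_mxEl mxE scale0r -[RHS](wP i).
  by apply: eq_bigr => i' _; rewrite row_mxEl mxE.
rewrite row_mxEr ord1 mxE eqxx scale1r.
by apply: eq_bigr => i' _; rewrite row_mxEr mxE.
Qed.

(** The zero column added here provides an entry to pivot on even if the formula
    has no equations. *)
Lemma pp1_lin (p : pp1 R) : exists k m (P : 'I_k -> 'I_m.+1 -> R) v, p = lin_pp P v.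
Proof.
case ef: (repr p) => [n m A B].
pose P (i : 'I_n.+1) (j : 'I_m.+1) :=
  if unlift ord0 j is Some j' then
    if unlift ord0 i is Some i' then A i' j' else - B 0 j'
  else 0.
exists n.+1, m, P, (fun i => (i == ord0)%:R); apply: pp1_psol_eq => M x.
rewrite psol_lin /psol ef; split=> [[y yP]|[w [wP ->]]].
  exists (fun i => if unlift ord0 i is Some i' then y i' else x); split=> [j|].
    rewrite big_ord_recl /P unlift_none; case: unliftP => [j' _|_].
      under eq_bigr do rewrite liftK.
      by have /= -> := yP j'; rewrite scaleNr addNr.
    by rewrite scale0r add0r big1 // => i _; rewrite scale0r.
  rewrite big_ord_recl unlift_none eqxx scale1r big1 ?addr0 // => i _.
  by rewrite scale0r.
exists (fun i => w (lift ord0 i)) => j /=.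
have <- : \sum_(i < n) P (lift ord0 i) (lift ord0 j) *: w (lift ord0 i) =
    \sum_(i < n) A i j *: w (lift ord0 i).
  by apply: eq_bigr => i _; rewrite /P !liftK.
rewrite [in RHS]big_ord_recl eqxx scale1r [in RHS]big1 ?addr0; last first.
  by move=> i _; rewrite scale0r.
move: (wP (lift ord0 j)); rewrite big_ord_recl [P ord0 _]/P liftK unlift_none.
by rewrite scaleNr addrC => /eqP; rewrite subr_eq0 => /eqP.
Qed.

End BoxSum.

Section NormalForm.
Variables (R : idomainType) (bezR : bezout_domain R).

(** Multiples of boxes are boxes: the multiples by [u] of the solutions of
    [box_pp a b] are the solutions of [box_pp (u * a) (b / gcd b u)]. *)
Lemma box_sum_scale (p : pp1 R) (u : R) : box_sum p ->
  exists q, box_sum q /\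
    forall (M : lmodType R) (x : M), psol q x <-> exists y, psol p y /\ x = u *: y.
Proof.
elim=> [a b|p1 p2 _ [q1 [s1 e1]] _ [q2 [s2 e2]]].
  have [g [b' [u' [r [t [eb eu e1]]]]]] := bezout_gcd bezR b u.
  exists (box_pp (u * a) b'); split=> [|M x]; first exact: BoxSumBox.
  rewrite psol_box; split=> [[z [xE b'x]]|[_ [/psol_box[z [-> bz]] ->]]].
    (* Locally either [b'] is invertible and [x = 0], or [u'] is and one may
       divide by it; [r b' + t u' = 1] glues the two cases. *)
    exists ((t * u') *: (a *: z)); split.
      apply/psol_box; exists ((t * u') *: z); split.
        by rewrite !scalerA mulrC.
      rewrite !scalerA; have -> : b * (t * u') * a = t * (b' * (u * a)).
        by rewrite eb eu; ring.
      by rewrite -scalerA -scalerA -xE b'x scaler0.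
    have -> : x = (t * u') *: x.
      rewrite -[LHS]scale1r -e1 scalerDl -(scalerA r) b'x scaler0.
      by rewrite add0r.
    by rewrite xE !scalerA; congr (_ *: z); ring.
  exists z; split; first by rewrite scalerA.
  have -> : b' *: (u *: (a *: z)) = u' *: (b *: (a *: z)).
    by rewrite !scalerA eb eu; congr (_ *: z); ring.
  by rewrite bz scaler0.
exists (q1 `|` q2)%O; split=> [|M x]; first exact: BoxSumJoin.
rewrite psol_join; split=> [[_ [_ [-> /e1[y [py ->]] /e2[z [pz ->]]]]]|].
  exists (y + z); split; last by rewrite scalerDr.
  by apply/psol_join; exists y, z.
move=> [_ [/psol_join[y [z [-> py pz]]] ->]].
exists (u *: y), (u *: z); split; first exact: scalerDr.
  by apply/e1; exists y.
by apply/e2; exists z.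
Qed.

Let lincombB (M : lmodType R) (I : finType) (a b : R) (f h : I -> R) (w : I -> M) :
  \sum_i (a * f i - b * h i) *: w i =
  a *: (\sum_i f i *: w i) - b *: (\sum_i h i *: w i).
Proof.
rewrite !scaler_sumr -sumrB; apply: eq_bigr => i _.
by rewrite scalerBl !scalerA.
Qed.

(** One step of diagonalization. After inverting the cofactor [u] of an entry
    that entry divides all the others, and its row and column can be cleared.
    Keeping track of the denominators, the formula and the result of the step
    agree up to multiplication by [u]. *)
Lemma pivot k m (P : 'I_k.+1 -> 'I_m -> R) (v : 'I_k.+1 -> R) (g : R) i0 j0
    (M : lmodType R) :
  let u := P i0 j0 in
  let F (x : M) := psol (lin_pp (fun i j => g * P i j) v) x in
  let G x := exists (W : M) (y : M), [/\ g *: W = 0,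
    psol (lin_pp
      (fun i j => g * (u * P (lift i0 i) j - P i0 j * P (lift i0 i) j0))
      (fun i => u * v (lift i0 i) - v i0 * P (lift i0 i) j0)) y
    & x = v i0 *: W + y] in
  (forall x, F x -> G (u *: x)) /\ (forall x, G x -> F (u *: x)).
Proof.
move=> u F G.
pose Q i j := u * P i j - P i0 j * P i j0.
pose d i := u * v i - v i0 * P i j0.
have Q0 j : Q i0 j = 0 by rewrite /Q /u mulrC subrr.
have d0 : d i0 = 0 by rewrite /d /u mulrC subrr.
have gsum (f : 'I_k.+1 -> R) (w : 'I_k.+1 -> M) :
    \sum_i (g * f i) *: w i = g *: \sum_i f i *: w i.
  by rewrite scaler_sumr; apply: eq_bigr => i _; rewrite scalerA.
split=> x.
  move=> /psol_lin[w [wP ->]].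
  exists (\sum_i P i j0 *: w i), (\sum_i d i *: w i); split.
  - by rewrite -gsum wP.
  - apply/psol_lin; exists (fun i => w (lift i0 i)); split=> [j|].
      have : \sum_i (g * Q i j) *: w i = 0.
        by rewrite gsum lincombB scalerBr !scalerA mulrC [g * P _ _]mulrC -!scalerA
                   -!gsum !wP !scaler0 subrr.
      by rewrite (bigD1_ord i0) //= Q0 mulr0 scale0r add0r.
    by rewrite (bigD1_ord i0) //= d0 scale0r add0r.
  - by rewrite lincombB addrC subrK.
move=> [W [y [gW /psol_lin[w' [w'P ->]] ->]]].
pose w i := if unlift i0 i is Some i' then w' i' else 0.
have sumw (f : 'I_k.+1 -> R) :
    \sum_i f i *: w i = \sum_i f (lift i0 i) *: w' i.
  rewrite (bigD1_ord i0) //= /w unlift_none scaler0 add0r.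
  by apply: eq_bigr => i _; rewrite liftK.
pose z := u *: W - u *: \sum_i P i j0 *: w i.
pose w2 i := u ^+ 2 *: w i + (if i == i0 then z else 0).
have sumw2 (f : 'I_k.+1 -> R) :
    \sum_i f i *: w2 i = u *: (f i0 *: W + \sum_i (u * f i - f i0 * P i j0) *: w i).
  have -> : \sum_i f i *: w2 i = u ^+ 2 *: (\sum_i f i *: w i) + f i0 *: z.
    rewrite /w2; under eq_bigr do rewrite scalerDr.
    rewrite big_split /=; congr (_ + _).
      by rewrite scaler_sumr; apply: eq_bigr => i _; rewrite !scalerA mulrC.
    rewrite (bigD1 i0) //= eqxx big1 ?addr0 // => i /negPf->.
    by rewrite scaler0.
  rewrite lincombB /z !scalerDr !scalerN !scalerA addrCA; congr (_ + (_ - _)).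
  - by rewrite mulrC.
  - by rewrite mulrC.
have := w'P; rewrite -/u => {}w'P.
apply/psol_lin; exists w2; split=> [j|].
  rewrite gsum sumw2 sumw scalerA mulrC -scalerA scalerDr scalerA mulrC -scalerA gW.
  rewrite scaler0 add0r scaler_sumr.
  under eq_bigr do rewrite scalerA.
  by rewrite w'P scaler0.
by rewrite sumw2 sumw.
Qed.

(** Every pp-1-formula is a sum of basic ones. The system is diagonalized by
    induction on the number of its rows, separately over the localisations at
    the cofactors of its entries; these cofactors being comaximal, the local
    results add up to the formula. *)
Lemma box_sum_lin k m (P : 'I_k -> 'I_m.+1 -> R) v : box_sum (lin_pp P v).
Proof.
elim: k P v => [|k IH] P v.
  have -> : lin_pp P v = box_pp 1 1.
    apply: pp1_psol_eq => M x; rewrite psol_lin psol_box; split.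
      by case=> w [_ ->]; exists 0; rewrite big_ord0 !scaler0.
    by case=> y [_]; rewrite scale1r => ->; exists (fun=> 0); rewrite big_ord0;
      split=> // j; rewrite big_ord0.
  exact: BoxSumBox.
have [g [P' [r [eP e1]]]] :=
  bezout_content bezR (ord0, ord0) (fun t : 'I_k.+1 * 'I_m.+1 => P t.1 t.2).
have -> : lin_pp P v = lin_pp (fun i j => g * P' (i, j)) v.
  congr (lin_pp _ _); apply/funext => i; apply/funext => j; exact: (eP (i, j)).
set F := lin_pp _ _.
have step t : exists q, box_sum q /\ (q <= F)%O /\
    forall (M : lmodType R) (x : M), psol F x -> psol q (P' t ^+ 2 *: x).
  case: t => i0 j0.
  pose L := lin_pp
    (fun i j => g * (P' (i0, j0) * P' (lift i0 i, j) - P' (i0, j) * P' (lift i0 i, j0)))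
    (fun i => P' (i0, j0) * v (lift i0 i) - v i0 * P' (lift i0 i, j0)).
  have pv (M : lmodType R) := pivot (fun i j => P' (i, j)) v g i0 j0 M.
  have [q1 [s1 q1P]] := box_sum_scale (v i0) (BoxSumBox 1 g).
  have [q [sq qP]] := box_sum_scale (P' (i0, j0)) (BoxSumJoin s1 (IH _ _ : box_sum L)).
  have GE (M : lmodType R) (y : M) : psol (q1 `|` L)%O y <-> exists (W : M) (y' : M),
      [/\ g *: W = 0, psol L y' & y = v i0 *: W + y'].
    rewrite psol_join; split=> [[_ [y' [-> /q1P[W [/psol_box[_ [_ gW]] ->]] Ly']]]|].
      by exists W, y'.
    move=> [W [y' [gW Ly' ->]]]; exists (v i0 *: W), y'; split=> //.
    by apply/q1P; exists W; split=> //; apply/psol_box; exists W; rewrite scale1r.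
  exists q; split=> //; split=> [|M x Fx].
    by apply/pp1_psolP => M x /qP[y [/GE Gy ->]]; apply: (pv M).2.
  apply/qP; exists (P' (i0, j0) *: x); split; last by rewrite scalerA expr2.
  by apply/GE; apply: (pv M).1.
have [q qP] := choice step.
have sq t : box_sum (q t) by case: (qP t).
have qF t : (q t <= F)%O by case: (qP t) => _ [].
have Fq t (M : lmodType R) (x : M) : psol F x -> psol (q t) (P' t ^+ 2 *: x).
  by case: (qP t) => _ [_]; apply.
have [Q [sQ qQ Qle]] := box_sum_lub (index_enum _) sq.
suff -> : F = Q by [].
apply/le_anti; rewrite Qle // andbT; apply/pp1_psolP => M x Fx.
rewrite -[x]scale1r.
apply: (@unit_ideal_squares R _ (index_enum _) P' r (fun c => psol Q (c *: x))).
- by move=> c d Qc Qd; rewrite scalerDl; apply: psolD.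
- by move=> c d Qd; rewrite -scalerA; apply: psolZ.
- move=> t; have /pp1_psolP := qQ t (mem_index_enum _); apply; exact: Fq.
- by rewrite e1 subrr scale0r; apply: psol0.
Qed.

Lemma pp1_box_sum (p : pp1 R) : box_sum p.
Proof. by have [k [m [P [v ->]]]] := pp1_lin p; apply: box_sum_lin. Qed.

End NormalForm.

(** * Distributivity *)

Section Distributivity.
Variables (R : idomainType) (bezR : bezout_domain R).
Implicit Types p q : pp1 R.

Lemma pp1_le_box p q :
  (forall a b, box_pp a b <= p -> box_pp a b <= q)%O -> (p <= q)%O.
Proof.
elim: (pp1_box_sum bezR p) => [a b|p1 p2 _ IH1 _ IH2] pq; first exact: pq.
by rewrite leUx IH1 ?IH2 // => a b le; apply: pq; rewrite lexU2 // le ?orbT.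
Qed.

(** In a cyclic module over a Bezout domain a decomposition [x = u + v] can be
    made proportional to [x]: where [u] divides [v], it divides [x] as well. *)
Lemma cls_join p q (m x : R) : psol (p `|` q)%O (cls m x) ->
  exists r, psol p (cls m (r * x)) /\ psol q (cls m ((1 - r) * x)).
Proof.
move=> /psol_join[U [V []]]; have [u ->] := clsP U; have [v ->] := clsP V.
rewrite -clsD => /cls_eq[k ->] pu qv.
have [g [u' [v' [r [t [eu ev e1]]]]]] := bezout_gcd bezR u v.
exists (r * u').
have -> : cls m (r * u' * (u + v + m * k)) = (r * (u' + v')) *: cls m u.
  by rewrite -clsZ; apply/cls_eq; exists (r * u' * k); rewrite eu ev; ring.
have -> : cls m ((1 - r * u') * (u + v + m * k)) = (t * (u' + v')) *: cls m v.
  rewrite -clsZ; apply/cls_eq; exists (t * v' * k).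
  by rewrite -e1 eu ev; ring.
by split; apply: psolZ.
Qed.

(** Locally a box is join-prime; globally a partition of unity selects, at each
    place, one of the two joinands. *)
Lemma box_le_join p q a b : (box_pp a b <= p `|` q)%O ->
  exists r, forall (M : lmodType R) (x : M), psol (box_pp a b) x ->
    psol p (r *: x) /\ psol q ((1 - r) *: x).
Proof.
move=> /box_le_psol/cls_join[r [pr qr]]; exists r => M x /psol_box[y [-> bx]].
by rewrite !scalerA; split; [apply: psol_cls pr _|apply: psol_cls qr _];
  rewrite mulrC -scalerA.
Qed.

Lemma pp1_meetUl p q (r : pp1 R) : ((p `|` q) `&` r = (p `&` r) `|` (q `&` r))%O.
Proof.
apply/le_anti/andP; split; last first.
  by rewrite leUx !leI2 ?lexx ?leUl ?leUr.
apply: pp1_le_box => a b; rewrite lexI => /andP[/box_le_join[s sP] /pp1_psolP br].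
apply/pp1_psolP => M x bx; have [px qx] := sP _ _ bx.
apply/psol_join; exists (s *: x), ((1 - s) *: x); split.
- by rewrite -scalerDl addrC subrK scale1r.
- by apply/psol_meet; split=> //; apply/psolZ/br.
- by apply/psol_meet; split=> //; apply/psolZ/br.
Qed.

Lemma pp1_joinIl p q (r : pp1 R) : ((p `&` q) `|` r = (p `|` r) `&` (q `|` r))%O.
Proof.
apply/le_anti/andP; split.
  by rewrite leUx !lexI !leUr !andbT leIxl ?leUl // leIxr ?leUl.
rewrite pp1_meetUl leUx andbC (le_trans (leIl _ _) (leUr _ _)) /=.
rewrite meetC pp1_meetUl leUx andbC (le_trans (leIl _ _) (leUr _ _)) /=.
by rewrite meetC leUl.
Qed.

(** Localised at a maximal ideal, where divisibility is total, the condition says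
    that [c] divides [a] or [b] divides [d]; [r] and [1 - r] patch the two
    alternatives together. *)
Lemma box_le_cobox (a b c d : R) : (box_pp a b <= cobox_pp c d)%O <->
  exists r k l, r * a = c * k /\ (1 - r) * d = b * l.
Proof.
split=> [/box_le_psol/cls_join[r [/psol_dvd[z0]]]|[r [k [l [rc rb]]]]]; last first.
  apply/pp1_psolP => M x /psol_box[y [ex bx]]; apply/psol_cobox.
  exists (k *: y), ((1 - r) *: x); split.
    rewrite scalerA -rc -scalerA -ex -scalerDl addrC subrK scale1r //.
  by rewrite scalerA mulrC rb mulrC -scalerA bx scaler0.
have [z ->] := clsP z0; rewrite -clsZ => /cls_eq[k ek] /psol_ann.
rewrite -clsZ => /cls_eq0[l el].
have [a0|an0] := eqVneq a 0.
  by exists 1, 0, 0; rewrite a0 !mulr0 subrr mul0r.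
exists (r - b * k), z, (l + k * d); split; first by rewrite mulrBl ek; ring.
apply: (mulIf an0).
have -> : (1 - (r - b * k)) * d * a = d * ((1 - r) * a) + b * k * d * a by ring.
by rewrite el; ring.
Qed.

Inductive cobox_meet : pp1 R -> Prop :=
  | CoboxMeetCobox c d : cobox_meet (cobox_pp c d)
  | CoboxMeetMeet p q : cobox_meet p -> cobox_meet q -> cobox_meet (p `&` q)%O.

Lemma cobox_meet_dvd (a : R) : cobox_meet (dvd_pp a).
Proof.
have -> : dvd_pp a = cobox_pp a 1.
  apply: pp1_psol_eq => M x; rewrite psol_dvd psol_cobox; split=> [[y ->]|].
    by exists y, 0; rewrite addr0 scaler0.
  by case=> y [z [->]]; rewrite scale1r => ->; exists y; rewrite addr0.
exact: CoboxMeetCobox.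
Qed.

Lemma cobox_meet_ann (b : R) : cobox_meet (ann_pp b).
Proof.
have -> : ann_pp b = cobox_pp 0 b.
  apply: pp1_psol_eq => M x; rewrite psol_ann psol_cobox; split=> [bx|].
    by exists 0, x; rewrite scaler0 add0r.
  by case=> y [z [-> bz]]; rewrite scale0r add0r.
exact: CoboxMeetCobox.
Qed.

Lemma dvd_join (a c g a' c' r t : R) :
  a = g * a' -> c = g * c' -> r * a' + t * c' = 1 ->
  (dvd_pp a `|` dvd_pp c)%O = dvd_pp g.
Proof.
move=> ea ec e1; apply: pp1_psol_eq => M x; rewrite psol_join psol_dvd; split.
  move=> [_ [_ [-> /psol_dvd[y ->] /psol_dvd[z ->]]]].
  by exists (a' *: y + c' *: z); rewrite scalerDr !scalerA -ea -ec.
move=> [y ->]; exists (a *: (r *: y)), (c *: (t *: y)); split.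
- rewrite !scalerA -scalerDl; congr (_ *: y).
  by rewrite ea ec -[LHS]mulr1 -e1; ring.
- by apply/psol_dvd; exists (r *: y).
- by apply/psol_dvd; exists (t *: y).
Qed.

Lemma ann_join (b d h b' d' r t : R) :
  b = h * b' -> d = h * d' -> r * b' + t * d' = 1 ->
  (ann_pp b `|` ann_pp d)%O = ann_pp (h * b' * d').
Proof.
move=> eb ed e1; apply: pp1_psol_eq => M x; rewrite psol_join psol_ann; split.
  move=> [u [v [-> /psol_ann bu /psol_ann dv]]]; rewrite scalerDr.
  have -> : (h * b' * d') *: u = d' *: (b *: u) by rewrite scalerA eb mulrC.
  have -> : (h * b' * d') *: v = b' *: (d *: v).
    by rewrite scalerA ed; congr (_ *: v); ring.
  by rewrite bu dv !scaler0 addr0.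
move=> e; exists ((t * d') *: x), ((r * b') *: x); split.
- by rewrite -scalerDl addrC e1 scale1r.
- apply/psol_ann; rewrite scalerA eb.
  have -> : h * b' * (t * d') = t * (h * b' * d') by ring.
  by rewrite -scalerA e scaler0.
- apply/psol_ann; rewrite scalerA ed.
  have -> : h * d' * (r * b') = r * (h * b' * d') by ring.
  by rewrite -scalerA e scaler0.
Qed.

(** By distributivity a sum of boxes is expanded into a meet of sums of
    divisibility and annihilation formulae, and each such sum is a cobox: sums of
    divisibility formulae take gcds, sums of annihilation formulae take lcms. *)
Lemma pp1_cobox_meet p : cobox_meet p.
Proof.
have joinM q1 q2 : cobox_meet q1 -> cobox_meet q2 -> cobox_meet (q1 `|` q2)%O.
  move=> m1; elim: m1 q2 => [c d|p1 p2 _ IH1 _ IH2] q2; last first.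
    by move=> m2; rewrite pp1_joinIl; apply: CoboxMeetMeet; [apply: IH1|apply: IH2].
  elim=> [c' d'|p1 p2 _ IH1 _ IH2]; last first.
    rewrite joinC pp1_joinIl; apply: CoboxMeetMeet; rewrite joinC //.
  have [g [c1 [c2 [r [t [ec ec' ce]]]]]] := bezout_gcd bezR c c'.
  have [h [d1 [d2 [r' [t' [ed ed' de]]]]]] := bezout_gcd bezR d d'.
  rewrite /cobox_pp joinACA (dvd_join ec ec' ce) (ann_join ed ed' de).
  exact: CoboxMeetCobox.
elim: (pp1_box_sum bezR p) => [a b|p1 p2 _ m1 _ m2]; last exact: joinM.
by apply: CoboxMeetMeet; [apply: cobox_meet_dvd|apply: cobox_meet_ann].
Qed.

End Distributivity.

(** * Breadth in modular lattices *)

Section Breadth.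
Variables (d : Order.disp_t) (L : latticeType d).
Implicit Types a b c x y z : L.
Local Open Scope order_scope.

Lemma breadth0_refl a : breadth0 a a.
Proof. by exists 0%N, (fun=> a); split. Qed.

Lemma breadth0_total a b : a <= b -> interval_total a b -> breadth0 a b.
Proof.
move=> ab tot; exists 1%N, (fun i => if i is 0 then a else b).
by split=> // -[].
Qed.

Lemma breadth0_trans b a c : breadth0 a b -> breadth0 b c -> breadth0 a c.
Proof.
move=> [m [u [u0 um uP]]] [n [v [v0 vn vP]]].
exists (m + n)%N, (fun i => if (i <= m)%N then u i else v (i - m)%N).
split=> [//||i imn].
  case: leqP => [|_]; last by rewrite addKn.
  by rewrite -[X in (_ <= X)%N]addn0 leq_add2l leqn0 => /eqP n0;
    rewrite n0 addn0 um -v0 -n0 vn.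
case: (ltngtP i m) => [im|im|im].
- exact: uP.
- by rewrite subSn ?(ltnW im) //; apply: vP; rewrite ltn_subLR ?(ltnW im).
- rewrite im subSnn um -v0; apply: vP.
  by rewrite -(ltn_add2l m) addn0 -{1}im.
Qed.

Let breadth0_image (f : L -> L) a b :
  {homo f : x y / x <= y} ->
  (forall x y, x <= y -> interval_total x y -> interval_total (f x) (f y)) ->
  breadth0 a b -> breadth0 (f a) (f b).
Proof.
move=> fle ftot [n [c [<- <- cP]]]; exists n, (f \o c); split=> // i /cP[le tot].
by split; [exact: fle|exact: ftot].
Qed.

Hypothesis modL : forall x y z, x <= z -> (x `|` y) `&` z <= x `|` (y `&` z).

(** Transposed intervals of a modular lattice are isomorphic, so a meet or a
    join with a fixed element maps chains onto chains. *)
Lemma breadth0_meetr z a b : breadth0 a b -> breadth0 (a `&` z) (b `&` z).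
Proof.
apply: (@breadth0_image (fun x => x `&` z)) => [x y xy|{}a {}b ab tot x y].
  exact: leI2.
suff le_of x' y' : a `&` z <= x' <= b `&` z -> a `&` z <= y' <= b `&` z ->
    x' `|` a <= y' `|` a -> x' <= y'.
  move=> xI yI; have tI t : a `&` z <= t <= b `&` z -> a <= t `|` a <= b.
    by move=> /andP[_]; rewrite leUr leUx ab lexI => /andP[-> _].
  by case/orP: (tot _ _ (tI _ xI) (tI _ yI)) => /le_of->; rewrite ?orbT.
move=> /andP[_]; rewrite lexI => /andP[_ xz] /andP[ay]; rewrite lexI => /andP[_ yz] xy.
have le : x' <= (y' `|` a) `&` z by rewrite lexI xz (le_trans (leUl _ _) xy).
by apply: le_trans le (le_trans (modL _ yz) _); rewrite leUx lexx.
Qed.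

Lemma breadth0_joinr z a b : breadth0 a b -> breadth0 (a `|` z) (b `|` z).
Proof.
apply: (@breadth0_image (fun x => x `|` z)) => [x y xy|{}a {}b ab tot x y].
  exact: leU2.
suff le_of x' y' : a `|` z <= x' <= b `|` z -> a `|` z <= y' <= b `|` z ->
    x' `&` b <= y' `&` b -> x' <= y'.
  move=> xI yI; have tI t : a `|` z <= t <= b `|` z -> a <= t `&` b <= b.
    by move=> /andP[]; rewrite leIr lexI ab leUx => /andP[-> _].
  by case/orP: (tot _ _ (tI _ xI) (tI _ yI)) => /le_of->; rewrite ?orbT.
move=> /andP[]; rewrite leUx => /andP[_ zx] xb /andP[]; rewrite leUx => /andP[_ zy] _ xy.
have le : x' <= (z `|` b) `&` x' by rewrite lexI lexx andbT joinC.
apply: le_trans le (le_trans (modL _ zx) _).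
by rewrite leUx zy meetC (le_trans xy) // leIl.
Qed.

Lemma breadth0_meet a b a' b' :
  breadth0 a b -> breadth0 a' b' -> breadth0 (a `&` a') (b `&` b').
Proof.
move=> ab ab'; apply: (@breadth0_trans (b `&` a')); first exact: breadth0_meetr.
by rewrite ![b `&` _]meetC; apply: breadth0_meetr.
Qed.

Lemma breadth0_join a b a' b' :
  breadth0 a b -> breadth0 a' b' -> breadth0 (a `|` a') (b `|` b').
Proof.
move=> ab ab'; apply: (@breadth0_trans (b `|` a')); first exact: breadth0_joinr.
by rewrite ![b `|` _]joinC; apply: breadth0_joinr.
Qed.

Lemma breadth0_sub a b x y :
  a <= x -> x <= y -> y <= b -> breadth0 a b -> breadth0 x y.
Proof.
move=> ax xy yb /(breadth0_meetr y)/(breadth0_joinr x).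
by rewrite (meet_l (le_trans ax xy)) (meet_r yb) (join_r ax) (join_l xy).
Qed.

End Breadth.

(** * Colon formulae and irreducible elements *)

Section Colon.
Variable R : comNzRingType.
Implicit Types p q : pp1 R.

(** The formula s x in p *)
Definition pp1_colon p (s : R) : pp1 R :=
  \pi_(pp1 R) (PPF (pp_A (repr p)) (s *: pp_B (repr p))).

Lemma psol_colon p s (M : lmodType R) (x : M) : psol (pp1_colon p s) x <-> psol p (s *: x).
Proof.
by rewrite psol_pi; split=> -[y yP]; exists y => j; have := yP j;
  rewrite /= mxE => ->; rewrite scalerA mulrC.
Qed.

Lemma colon_meet p q s : pp1_colon (p `&` q)%O s = (pp1_colon p s `&` pp1_colon q s)%O.
Proof. by apply: pp1_psol_eq => M x; rewrite psol_meet !psol_colon psol_meet. Qed.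

Lemma colon_mul p s t : pp1_colon p (s * t) = pp1_colon (pp1_colon p s) t.
Proof. by apply: pp1_psol_eq => M x; rewrite !psol_colon scalerA. Qed.

Lemma le_colon p s : (p <= pp1_colon p s)%O.
Proof. by apply/pp1_psolP => M x px; apply/psol_colon/psolZ. Qed.

Lemma colon_ann b s : pp1_colon (ann_pp b) s = ann_pp (b * s).
Proof. by apply: pp1_psol_eq => M x; rewrite psol_colon !psol_ann scalerA. Qed.

Lemma colon_dvd a s : pp1_colon (dvd_pp (s * a)) s = (dvd_pp a `|` ann_pp s)%O.
Proof.
apply: pp1_psol_eq => M x; rewrite psol_colon -/(cobox_pp a s) psol_dvd psol_cobox.
split=> [[y e]|[y [z [-> sz]]]].
  exists y, (x - a *: y); split; first by rewrite addrC subrK.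
  by rewrite scalerBr e scalerA subrr.
by exists y; rewrite scalerDr sz addr0 scalerA.
Qed.

Lemma ann1_le q : (ann_pp 1 <= q)%O.
Proof.
apply/pp1_psolP => M x /psol_ann; rewrite scale1r => ->; exact: psol0.
Qed.

Lemma box_leP a b p : (forall (M : lmodType R) (y : M),
  b *: (a *: y) = 0 -> psol p (a *: y)) -> (box_pp a b <= p)%O.
Proof. by move=> H; apply/pp1_psolP => M x /psol_box[y [-> /H]]. Qed.

End Colon.

Section IrreducibleColon.
Variables (R : idomainType) (bezR : bezout_domain R).
Implicit Types (a b c : R) (q : pp1 R).

(** In R / a b R a decomposition of [s * a] may be taken proportional to
    [s * a], and then it comes from a decomposition of [a]. *)
Lemma colon_join (p q : pp1 R) s :
  pp1_colon (p `|` q)%O s = (pp1_colon p s `|` pp1_colon q s)%O.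
Proof.
apply/le_anti/andP; split; last first.
  rewrite leUx; apply/andP; split; apply/pp1_psolP => M x /psol_colon sx.
    by apply/psol_colon; apply: psol_le sx; exact: leUl.
  by apply/psol_colon; apply: psol_le sx; exact: leUr.
apply: (pp1_le_box bezR) => a b; rewrite !box_le_psol => /psol_colon.
rewrite -clsZ => /(cls_join bezR)[r [pr qr]]; apply/psol_join.
exists (cls _ (r * a)), (cls _ ((1 - r) * a)); split.
- by rewrite -clsD; congr (cls _ _); ring.
- by apply/psol_colon; rewrite -clsZ mulrCA.
- by apply/psol_colon; rewrite -clsZ mulrCA.
Qed.

(** Two incomparable formulae of an interval are told apart by boxes, so it is
    enough to compare boxes, modulo the lower end of the interval. *)
Lemma interval_total_box (q1 q2 : pp1 R) :
  (forall a b a' b', box_pp a b <= q2 -> box_pp a' b' <= q2 ->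
     ~ (box_pp a b <= q1) -> ~ (box_pp a' b' <= q1) ->
     box_pp a b <= box_pp a' b' `|` q1 \/ box_pp a' b' <= box_pp a b `|` q1)%O ->
  interval_total q1 q2.
Proof.
move=> cmp x y /andP[q1x xq2] /andP[q1y yq2].
have box_notin z t : ~ (z <= t)%O -> exists a b, (box_pp a b <= z)%O /\ ~ (box_pp a b <= t)%O.
  move=> nzt; apply: contrapT => none; apply: nzt; apply: (pp1_le_box bezR) => a b abz.
  by apply: contrapT => nabt; apply: none; exists a, b.
apply/orP; have [|/box_notin[a [b [abx naby]]]] := pselect (x <= y)%O; first by left.
have [|/box_notin[a' [b' [aby nabx]]]] := pselect (y <= x)%O; first by right.
have [] := cmp a b a' b' (le_trans abx xq2) (le_trans aby yq2).
- by move=> le; apply: naby; apply: le_trans le q1y.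
- by move=> le; apply: nabx; apply: le_trans le q1x.
- by move=> le; case: naby; apply: le_trans le _; rewrite leUx aby.
- by move=> le; case: nabx; apply: le_trans le _; rewrite leUx abx.
Qed.

Variables (p : R) (irr_p : irreducible_elt p).

(** In the valuation domain obtained by localising at [p] any two elements are
    comparable for divisibility; [u] is the denominator. *)
Lemma irreducible_dvd_total a c :
  exists u r s : R, r * u + s * p = 1 /\
    ((exists k, u * c = a * k) \/ (exists k, u * a = c * k)).
Proof.
have [g [a' [c' [al [be [ea ec e1]]]]]] := bezout_gcd bezR a c.
have [[v ev]|na] := pselect (exists v, a' = p * v); last first.
  have [r [s e]] := irreducible_coprime bezR irr_p na.
  by exists a', r, s; split=> //; left; exists c'; rewrite ea ec; ring.
have [[w ew]|nc] := pselect (exists w, c' = p * w); last first.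
  have [r [s e]] := irreducible_coprime bezR irr_p nc.
  by exists c', r, s; split=> //; right; exists a'; rewrite ea ec; ring.
exists 0, 0, (al * v + be * w); split; first by rewrite -e1 ev ew; ring.
by left; exists 0; rewrite mul0r mulr0.
Qed.

Lemma ann_interval_total b : interval_total (ann_pp b) (ann_pp (b * p)).
Proof.
(* Only the divisor [a] of a box matters in this interval. *)
have fill a c : (box_pp a c <= ann_pp (b * p))%O -> ~ (box_pp a c <= ann_pp b)%O ->
    (box_pp a (b * p) <= box_pp a c `|` ann_pp b)%O.
  move=> /box_le_psol/psol_ann; rewrite -clsZ => /cls_eq0[k ek] nle.
  have an0 : a != 0.
    apply: contra_notN nle => /eqP->; apply: box_leP => M y _.
    by rewrite scale0r; apply: psol0.
  have {}ek : b * p = c * k by apply: (mulIf an0); rewrite ek; ring.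
  have [|r [s e]] := irreducible_coprime bezR irr_p (u := k).
    move=> [v ev]; apply: nle; apply: box_leP => M y cy; apply/psol_ann.
    have -> : b = v * c.
      by apply: (mulIf (x := p)); [case: irr_p|rewrite ek ev; ring].
    by rewrite -scalerA cy scaler0.
  apply: box_leP => M y bpy; apply/psol_join.
  exists ((r * k) *: (a *: y)), ((s * p) *: (a *: y)); split.
  - by rewrite -scalerDl e scale1r.
  - apply/psol_box; exists ((r * k) *: y); split; first by rewrite !scalerA mulrC.
    rewrite [LHS]scalerA; have -> : c * (r * k) = r * (b * p) by rewrite ek; ring.
    by rewrite -scalerA bpy scaler0.
  - apply/psol_ann; rewrite [LHS]scalerA.
    have -> : b * (s * p) = s * (b * p) by ring.
    by rewrite -scalerA bpy scaler0.
have cmp a a' u r s k : r * u + s * p = 1 -> u * a' = a * k ->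
    (box_pp a' (b * p) <= box_pp a (b * p) `|` ann_pp b)%O.
  move=> e ek; apply: box_leP => M y bpy; apply/psol_join.
  exists ((r * u) *: (a' *: y)), ((s * p) *: (a' *: y)); split.
  - by rewrite -scalerDl e scale1r.
  - apply/psol_box; exists ((r * k) *: y); split.
      by rewrite !scalerA; congr (_ *: y); rewrite -mulrA ek; ring.
    by rewrite [LHS]scalerA mulrC -scalerA bpy scaler0.
  - apply/psol_ann; rewrite [LHS]scalerA.
    have -> : b * (s * p) = s * (b * p) by ring.
    by rewrite -scalerA bpy scaler0.
apply: interval_total_box => a c a' c' ac ac' nac nac'.
have sub e f : (box_pp e f <= ann_pp (b * p))%O -> (box_pp e f <= box_pp e (b * p))%O.
  by move=> le; rewrite /box_pp lexI leIl.
have [u [r [s [e [[k ek]|[k ek]]]]]] := irreducible_dvd_total a a'; [right|left].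
  apply: le_trans (sub _ _ ac') (le_trans (cmp _ _ _ _ _ _ e ek) _).
  by rewrite leUx fill // leUr.
apply: le_trans (sub _ _ ac) (le_trans (cmp _ _ _ _ _ _ e ek) _).
by rewrite leUx fill // leUr.
Qed.

Lemma dvd_interval_total a : interval_total (dvd_pp (p * a)) (dvd_pp a).
Proof.
(* Only the annihilator [c] of a box matters in this interval. *)
have fill f c : (box_pp f c <= dvd_pp a)%O -> ~ (box_pp f c <= dvd_pp (p * a))%O ->
    (box_pp a c <= box_pp f c `|` dvd_pp (p * a))%O.
  move=> /box_le_psol/psol_dvd[z0]; have [z ->] := clsP z0.
  rewrite -clsZ => /cls_eq[k ek] nle.
  have fy (M : lmodType R) (y : M) : c *: (f *: y) = 0 -> f *: y = (a * z) *: y.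
    move=> cy; have fck : (f * c * k) *: y = 0.
      have -> : f * c * k = k * (c * f) by ring.
      by rewrite -!scalerA cy scaler0.
    by rewrite [in LHS]ek scalerDl fck addr0.
  have [|r [s e]] := irreducible_coprime bezR irr_p (u := z).
    move=> [v ev]; apply: nle; apply: box_leP => M y cy; apply/psol_dvd.
    by exists (v *: y); rewrite fy // ev scalerA; congr (_ *: y); ring.
  apply: box_leP => M y cy; apply/psol_join.
  exists ((r * z) *: (a *: y)), ((s * p) *: (a *: y)); split.
  - by rewrite -scalerDl e scale1r.
  - apply/psol_box; exists ((r * (1 - c * k)) *: y); split.
      have -> : (r * z) *: (a *: y) = r *: ((a * z) *: y).
        by rewrite !scalerA; congr (_ *: y); ring.
      have -> : a * z = f - f * c * k by rewrite {1}ek addrK.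
      by rewrite !scalerA; congr (_ *: y); ring.
    by rewrite [LHS]scalerA mulrC -scalerA cy scaler0.
  - apply/psol_dvd; exists (s *: y).
    by rewrite !scalerA; congr (_ *: y); ring.
have cmp c c' u r s k : r * u + s * p = 1 -> u * c' = c * k ->
    (box_pp a c <= box_pp a c' `|` dvd_pp (p * a))%O.
  move=> e ek; apply: box_leP => M y cy; apply/psol_join.
  exists ((r * u) *: (a *: y)), ((s * p) *: (a *: y)); split.
  - by rewrite -scalerDl e scale1r.
  - apply/psol_box; exists ((r * u) *: y); split; first by rewrite !scalerA mulrC.
    rewrite [LHS]scalerA; have -> : c' * (r * u) = r * k * c.
      by rewrite -mulrA [k * c]mulrC -ek; ring.
    by rewrite -scalerA cy scaler0.
  - apply/psol_dvd; exists (s *: y).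
    by rewrite !scalerA; congr (_ *: y); ring.
apply: interval_total_box => f c f' c' fc fc' nfc nfc'.
have sub e g : (box_pp e g <= dvd_pp a)%O -> (box_pp e g <= box_pp a g)%O.
  by move=> le; rewrite lexI le leIr.
have [u [r [s [e [[k ek]|[k ek]]]]]] := irreducible_dvd_total c c'; [left|right].
  apply: le_trans (sub _ _ fc) (le_trans (cmp _ _ _ _ _ _ e ek) _).
  by rewrite leUx fill // leUr.
apply: le_trans (sub _ _ fc') (le_trans (cmp _ _ _ _ _ _ e ek) _).
by rewrite leUx fill // leUr.
Qed.

Lemma pp1_modular (x y z : pp1 R) :
  (x <= z -> (x `|` y) `&` z <= x `|` (y `&` z))%O.
Proof. by move=> /meet_l xz; rewrite pp1_meetUl // xz. Qed.

(** Taking colons by [p] commutes with meets and joins, and so it suffices to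
    consider divisibility and annihilation formulae. *)
Lemma breadth0_colon_irreducible q : breadth0 q (pp1_colon q p).
Proof.
have breadth_ann b : breadth0 (ann_pp b) (ann_pp (b * p)).
  apply: breadth0_total; last exact: ann_interval_total.
  by rewrite -colon_ann; apply: le_colon.
have breadth_dvd a : breadth0 (dvd_pp a) (pp1_colon (dvd_pp a) p).
  have [[a' ->]|na] := pselect (exists a', a = p * a').
    rewrite colon_dvd; apply: (@breadth0_trans _ _ (dvd_pp a')).
      apply: breadth0_total; last exact: dvd_interval_total.
      apply/pp1_psolP => M x /psol_dvd[y ->]; apply/psol_dvd; exists (p *: y).
      by rewrite scalerA mulrC.
    have := breadth0_joinr pp1_modular (dvd_pp a') (breadth_ann 1).
    by rewrite mul1r (join_r (ann1_le _)) joinC.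
  have [r [s e]] := irreducible_coprime bezR irr_p na.
  have -> : pp1_colon (dvd_pp a) p = dvd_pp a.
    apply/le_anti; rewrite le_colon andbT; apply/pp1_psolP => M x /psol_colon.
    move=> /psol_dvd[y ey]; apply/psol_dvd; exists (r *: x + s *: y).
    rewrite -[LHS]scale1r -e scalerDl -[(s * p) *: x]scalerA ey scalerDr.
    by rewrite !scalerA ![a * _]mulrC.
  exact: breadth0_refl.
elim: (pp1_box_sum bezR q) => [a b|q1 q2 _ IH1 _ IH2].
  rewrite colon_meet colon_ann; apply: breadth0_meet => //; exact: pp1_modular.
rewrite colon_join; apply: breadth0_join => //; exact: pp1_modular.
Qed.

End IrreducibleColon.

Lemma breadth0_colon (R : idomainType) (bezR : bezout_domain R) (s : R) (q : pp1 R) :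
  unit_irr_generated s -> breadth0 q (pp1_colon q s).
Proof.
move=> Ss; elim: Ss q => {s} [u uu|p irr_p|s t _ IHs _ IHt] q.
- have -> : pp1_colon q u = q.
    apply/le_anti; rewrite le_colon andbT; apply/pp1_psolP => M x /psol_colon.
    by move=> /(psolZ u^-1); rewrite scalerA mulVr // scale1r.
  exact: breadth0_refl.
- exact: breadth0_colon_irreducible.
- by rewrite colon_mul; apply: breadth0_trans (IHs q) (IHt _).
Qed.

(** * Totally ordered intervals *)

Section Separation.
Variables (R : idomainType) (bezR : bezout_domain R) (nfR : ~ GRing.field_axiom R).

(** For [e = 0] the factors come from a nonzero nonunit, which exists because [R]
    is not a field. *)
Lemma unit_irr_factor (e : R) :
  unit_irr_generated e \/ exists e1 e2 f : R,
    [/\ e = e1 * e2 * f, e1 != 0, e2 != 0, e1 \isn't a GRing.unit & e2 \isn't a GRing.unit].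
Proof.
have [->|en0] := eqVneq e 0.
  right; have [q [q0 qu]] : exists q : R, q != 0 /\ q \isn't a GRing.unit.
    apply: contrapT => none; apply: nfR => q q0; apply: contrapT => /negP qu.
    by apply: none; exists q.
  by exists q, q, 0; split=> //; rewrite mulr0.
have [ue|nue] := boolP (e \is a GRing.unit); first by left; apply: UnitIrrUnit.
have [irr|nirr] := pselect (irreducible_elt e); first by left; apply: UnitIrrIrr.
right; apply: contrapT => none; apply: nirr; split=> // e1 e2 ee.
apply/negPn; rewrite negb_or; apply/negP => /andP[n1 n2]; apply: none.
exists e1, e2, 1; rewrite mulr1; split=> //.
  by apply: contraNneq en0 => e0; rewrite ee e0 mul0r.
by apply: contraNneq en0 => e0; rewrite ee e0 mulr0.
Qed.

Lemma dvd_pp_le (a c k : R) : a = c * k -> (dvd_pp a <= dvd_pp c)%O.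
Proof.
move=> ->; apply/pp1_psolP => M x /psol_dvd[y ->]; apply/psol_dvd.
by exists (k *: y); rewrite scalerA.
Qed.

Lemma ann_pp_le (b d k : R) : d = b * k -> (ann_pp b <= ann_pp d)%O.
Proof.
move=> ->; apply/pp1_psolP => M x /psol_ann bx; apply/psol_ann.
by rewrite mulrC -scalerA bx scaler0.
Qed.

(** With [g = gcd a c] and [h = gcd b d] the difference between [box_pp a b] and
    [cobox_pp c d] is governed by [e = gcd (c / g) (b / h)], and [e] multiplies
    the former into the latter. If [e1 * e2] divides [e], with [e1] and [e2]
    nonzero nonunits, then the formulae [dvd_pp (a * e1)] and [ann_pp (h * e1)]
    contradict the hypothesis: one of the two inequalities fails locally at the
    maximal ideals that contain [e2], the other at those that contain [e1]. *)
Lemma box_cobox_separation (a b c d : R) :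
  (forall X Y : pp1 R, X `&` box_pp a b <= Y `|` cobox_pp c d \/
                       Y `&` box_pp a b <= X `|` cobox_pp c d)%O ->
  exists s, unit_irr_generated s /\ (box_pp a b <= pp1_colon (cobox_pp c d) s)%O.
Proof.
move=> tot.
have [g [a' [c' [r1 [t1 [ea ec ac1]]]]]] := bezout_gcd bezR a c.
have [h [b' [d' [r2 [t2 [eb ed bd1]]]]]] := bezout_gcd bezR b d.
have [e [c1 [b1 [al [be [ec' eb' cb1]]]]]] := bezout_gcd bezR c' b'.
have trivial : (box_pp a b <= cobox_pp c d)%O ->
    exists s, unit_irr_generated s /\ (box_pp a b <= pp1_colon (cobox_pp c d) s)%O.
  move=> le; exists 1; split; first exact: UnitIrrUnit (unitr1 _).
  exact: le_trans le (le_colon _ _).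
have [g0|gn0] := eqVneq g 0.
  apply: trivial; apply/box_le_cobox => //.
  by exists 1, 0, 0; rewrite ea g0 !mul0r subrr; split; ring.
have [h0|hn0] := eqVneq h 0.
  apply: trivial; apply/box_le_cobox => //.
  by exists 0, 0, 0; rewrite ed h0 !mul0r; split; ring.
have [Se|[e1 [e2 [f [ee e1n0 e2n0 e1nu e2nu]]]]] := unit_irr_factor e.
  exists e; split=> //; apply: box_leP => M y by0; apply/psol_colon/psol_cobox.
  exists ((al * a') *: y), ((be * b') *: (a *: y)); split.
    rewrite !scalerA -scalerDl; congr (_ *: y).
    by rewrite -[e]mulr1 -cb1 eb' ec ec' ea; ring.
  have -> : d *: ((be * b') *: (a *: y)) = (d' * be) *: (b *: (a *: y)).
    by rewrite !scalerA; congr (_ *: y); rewrite ed eb; ring.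
  by rewrite by0 scaler0.
have ec2 : c' = e1 * e2 * (f * c1) by rewrite ec' ee; ring.
have eb2 : b' = e1 * e2 * (f * b1) by rewrite eb' ee; ring.
(* A divisor [u] of [b'] and of [c'] is coprime to [a'] and to [d']. *)
have comax u m n r k l : c' = u * m -> b' = u * n ->
    r * a' = u * k -> (1 - r) * d' = u * l -> u \is a GRing.unit.
  move=> ecu ebu rk rl; apply/unitrP.
  exists (r1 * k + r * t1 * m + ((1 - r) * r2 * n + t2 * l)).
  suff e1' : u * (r1 * k + r * t1 * m + ((1 - r) * r2 * n + t2 * l)) = 1.
    by split; rewrite // mulrC.
  have -> : u * (r1 * k + r * t1 * m + ((1 - r) * r2 * n + t2 * l)) =
    r1 * (u * k) + r * t1 * (u * m) + ((1 - r) * r2 * (u * n) + t2 * (u * l)) by ring.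
  rewrite -rk -rl -ecu -ebu.
  have -> : r1 * (r * a') + r * t1 * c' + ((1 - r) * r2 * b' + t2 * ((1 - r) * d')) =
    r * (r1 * a' + t1 * c') + (1 - r) * (r2 * b' + t2 * d') by ring.
  by rewrite ac1 bd1; ring.
case: (tot (dvd_pp (a * e1)) (ann_pp (h * e1))) => le.
- have : (box_pp (a * e1) (h * e1 * e2) <= cobox_pp c (h * e1 * d'))%O.
    apply: le_trans (le_trans le _); first rewrite !lexI leIl /=.
      rewrite (le_trans (leIl _ _) (dvd_pp_le (erefl _))) /=.
      apply: le_trans (leIr _ _) (ann_pp_le (k := f * b1) _).
      by rewrite eb eb2; ring.
    rewrite !leUx leUl (le_trans (ann_pp_le (erefl _)) (leUr _ _)) /=.
    by apply: le_trans (ann_pp_le (k := e1) _) (leUr _ _); rewrite ed; ring.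
  move=> /(box_le_cobox bezR)[r [k [l [rk rl]]]]; case/negP: e2nu.
  apply: (comax e2 (e1 * (f * c1)) (e1 * (f * b1)) r (f * c1 * k) l).
  + by rewrite ec2; ring.
  + by rewrite eb2; ring.
  + apply: (mulfI gn0); apply: (mulfI e1n0); move: rk; rewrite ea ec ec2 => rk.
    transitivity (r * (g * a' * e1)); first by ring.
    by rewrite rk; ring.
  + apply: (mulfI hn0); apply: (mulfI e1n0).
    transitivity ((1 - r) * (h * e1 * d')); first by ring.
    by rewrite rl; ring.
- have : (box_pp a (h * e1) <= cobox_pp (g * e1) d)%O.
    apply: le_trans (le_trans le _); first rewrite !lexI leIr leIl /=.
      apply: le_trans (leIr _ _) (ann_pp_le (k := e2 * (f * b1)) _).
      by rewrite eb eb2; ring.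
    rewrite !leUx leUr andbT; apply/andP; split.
      by apply: le_trans (dvd_pp_le (k := a') _) (leUl _ _); rewrite ea; ring.
    apply: le_trans (dvd_pp_le (k := e2 * (f * c1)) _) (leUl _ _).
    by rewrite ec ec2; ring.
  move=> /(box_le_cobox bezR)[r [k [l [rk rl]]]]; case/negP: e1nu.
  apply: (comax e1 (e2 * (f * c1)) (e2 * (f * b1)) r k l).
  + by rewrite ec2; ring.
  + by rewrite eb2; ring.
  + apply: (mulfI gn0); transitivity (r * a); first by rewrite ea; ring.
    by rewrite rk; ring.
  + apply: (mulfI hn0); transitivity ((1 - r) * d); first by rewrite ed; ring.
    by rewrite rl; ring.
Qed.

(** Totality is used in the form that meets with [p] and joins with [q] compare
    any two formulae. This form is inherited when [p] shrinks and [q] grows, and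
    so the normal forms reduce [p] to a box and [q] to a cobox. *)
Lemma interval_total_colon (p q : pp1 R) : interval_total q p -> (q <= p)%O ->
  exists s, unit_irr_generated s /\ (p <= pp1_colon q s)%O.
Proof.
move=> tot qp.
have {tot} : forall X Y : pp1 R, (X `&` p <= Y `|` q \/ Y `&` p <= X `|` q)%O.
  move=> X Y; have inI Z : (q <= (Z `&` p) `|` q <= p)%O by rewrite leUr leUx leIr qp.
  case/orP: (tot _ _ (inI X) (inI Y)); rewrite leUx => /andP[le _]; [left|right];
    by apply: le_trans le _; rewrite leU2 ?leIl ?lexx.
have le_colonl (u v : pp1 R) s t : (u <= pp1_colon v s)%O -> (u <= pp1_colon v (s * t))%O.
  by move=> le; rewrite colon_mul (le_trans le (le_colon _ _)).
have le_colonr (u v : pp1 R) s t : (u <= pp1_colon v t)%O -> (u <= pp1_colon v (s * t))%O.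
  by rewrite mulrC; apply: le_colonl.
elim: (pp1_box_sum bezR p) {qp} => {p} [a b|p1 p2 _ IH1 _ IH2] tot; last first.
  have sub p' : (p' <= p1 `|` p2)%O ->
      forall X Y : pp1 R, (X `&` p' <= Y `|` q \/ Y `&` p' <= X `|` q)%O.
    by move=> le X Y; case: (tot X Y) => H; [left|right]; apply: le_trans (leI2 _ le) H.
  have [s1 [S1 le1]] := IH1 (sub _ (leUl _ _)).
  have [s2 [S2 le2]] := IH2 (sub _ (leUr _ _)).
  exists (s1 * s2); split; first exact: UnitIrrMul.
  by rewrite leUx le_colonl // le_colonr.
elim: (pp1_cobox_meet bezR q) tot => {q} [c d|q1 q2 _ IH1 _ IH2] tot.
  exact: box_cobox_separation.
have sub q' : (q1 `&` q2 <= q')%O ->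
    forall X Y : pp1 R, (X `&` box_pp a b <= Y `|` q' \/ Y `&` box_pp a b <= X `|` q')%O.
  by move=> le X Y; case: (tot X Y) => H; [left|right]; apply: le_trans H (leU2 _ le).
have [s1 [S1 le1]] := IH1 (sub _ (leIl _ _)).
have [s2 [S2 le2]] := IH2 (sub _ (leIr _ _)).
exists (s1 * s2); split; first exact: UnitIrrMul.
by rewrite colon_meet lexI le_colonl // le_colonr.
Qed.

End Separation.

(** * Localisation *)

(** The type [restr M] does not determine the ring morphism, so its module
    structure has to be given explicitly. *)
Definition restr_lmod (R R' : comNzRingType) (h : {rmorphism R -> R'})
    (M : lmodType R') : lmodType R := Defs_restr__canonical__GRing_Lmodule h M.

Lemma psol_map (R R' : comNzRingType) (h : {rmorphism R -> R'}) (p : pp1 R)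
    (M : lmodType R') (x : M) :
  psol (pp1_map h p) x <-> psol p (x : restr_lmod h M).
Proof. by rewrite psol_pi; apply: ppsol_map. Qed.

Lemma pp1_map_meet (R R' : comNzRingType) (h : {rmorphism R -> R'}) (p q : pp1 R) :
  pp1_map h (p `&` q)%O = (pp1_map h p `&` pp1_map h q)%O.
Proof. by apply: pp1_psol_eq => M x; rewrite psol_meet !psol_map psol_meet. Qed.

Lemma pp1_map_join (R R' : comNzRingType) (h : {rmorphism R -> R'}) (p q : pp1 R) :
  pp1_map h (p `|` q)%O = (pp1_map h p `|` pp1_map h q)%O.
Proof.
apply: pp1_psol_eq => M x; rewrite psol_join psol_map psol_join.
by split=> -[u [v [-> pu qv]]]; exists u, v; split=> //; move: pu qv; rewrite !psol_map.
Qed.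

Section LocalisationSR.
Variable R : idomainType.
Local Notation RS := (localisation (@SR R)).
Local Notation loc := (@loc_map R (@SR R)).

Lemma loc_inj : injective loc.
Proof.
move=> x y /(congr1 (@loc_val _ _)) /= e.
by apply/eqP; rewrite -subr_eq0 -tofrac_eq0 tofracB e subrr.
Qed.

Lemma loc_inverse (s : R) : s \in @SR R -> exists t : RS, t * loc s = 1.
Proof.
move=> Ss; have P : (FracField.tofrac s)^-1 \in loc_pred (@SR R).
  by apply/asboolP; exists 1, s; rewrite tofrac1 div1r.
exists (Loc P); apply: val_inj.
by rewrite rmorphM rmorph1 /= mulVf // tofrac_eq0 SR_neq0.
Qed.

Lemma common_denominator (T : finType) (z : T -> RS) :
  exists s (z' : T -> R), s \in @SR R /\ forall t, loc s * z t = loc (z' t).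
Proof.
have frac t : exists rs : R * R, rs.2 \in @SR R /\ loc rs.2 * z t = loc rs.1.
  case: (z t) => x xP; have [r [s [Ss ex]]] := asboolP _ xP.
  exists (r, s); split=> //; apply: val_inj; rewrite rmorphM /= ex mulrC divfK //.
  by rewrite tofrac_eq0 SR_neq0.
have [f fP] := choice frac.
exists (\prod_t (f t).2), (fun t => (f t).1 * \prod_(t' | t' != t) (f t').2).
split=> [|t]; first by apply: rpred_prod => t _; case: (fP t).
rewrite (bigD1 t) //= !rmorphM /= mulrAC; case: (fP t) => _ <-.
by rewrite -!mulrA.
Qed.

(** For a box [p] the inequality over the localisation is witnessed by finitely
    many fractions, namely a solution of [q] in a cyclic module; their common
    denominator is [s]. *)
Lemma piS_le (bezR : bezout_domain R) (p q : pp1 R) :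
  (piS p <= piS q)%O <-> exists s, s \in @SR R /\ (p <= pp1_colon q s)%O.
Proof.
split=> [|[s [Ss /pp1_psolP le]]]; last first.
  apply/pp1_psolP => M x /psol_map/le/psol_colon qsx.
  have {}qsx : psol (piS q) (loc s *: x) by apply/psol_map.
  have [t t1] := loc_inverse Ss.
  by rewrite -[x]scale1r -t1 -scalerA; apply: psolZ.
elim: (pp1_box_sum bezR p) => [a b|p1 p2 _ IH1 _ IH2]; last first.
  rewrite /piS pp1_map_join leUx => /andP[/IH1[s1 [S1 le1]] /IH2[s2 [S2 le2]]].
  exists (s1 * s2); split; first exact: rpredM.
  rewrite leUx {1}colon_mul mulrC colon_mul (le_trans le1) ?le_colon //.
  by rewrite (le_trans le2) ?le_colon.
pose m := loc a * loc b; pose x : cyclic m := cls m (loc a).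
move/pp1_psolP/(_ _ x).
have px : psol (piS (box_pp a b)) x.
  apply/psol_map/psol_box; exists (cls m 1); split.
    by rewrite -[RHS]/(loc a *: cls m 1) -clsZ mulr1.
  rewrite -[LHS]/(loc b *: cls m (loc a)) -clsZ; apply/cls_eq0.
  by exists 1; rewrite mulr1 mulrC.
move=> /(_ px)/psol_map[y yP].
have [z zP] := choice (fun i => clsP (y i)).
have kP j : exists k, \sum_i loc (pp_A (repr q) i j) * z i =
    loc (pp_B (repr q) 0 j) * loc a + m * k.
  apply/cls_eq; rewrite cls_sum [RHS]clsZ.
  have := yP j; rewrite -[RHS]/(loc _ *: x) => <-.
  by apply: eq_bigr => i _; rewrite clsZ -zP.
have [k {}kP] := choice kP.
have [s1 [z' [S1 z'P]]] := common_denominator z.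
have [s2 [k' [S2 k'P]]] := common_denominator k.
exists (s1 * s2); split; first exact: rpredM.
apply: box_leP => M y' by0; apply/psol_colon.
exists (fun i => (s2 * z' i) *: y') => j.
have e : \sum_i pp_A (repr q) i j * (s2 * z' i) =
    pp_B (repr q) 0 j * (s1 * s2 * a) + s1 * k' j * (b * a).
  apply: loc_inj; rewrite rmorph_sum rmorphD !rmorphM /= -k'P.
  transitivity (loc s1 * loc s2 * \sum_i loc (pp_A (repr q) i j) * z i).
    rewrite big_distrr; apply: eq_bigr => i _; rewrite !rmorphM /= -z'P /=; ring.
  by rewrite kP /m; ring.
under eq_bigr do rewrite scalerA.
rewrite -scaler_suml e scalerDl -[(_ * (b * a)) *: _]scalerA -[(b * a) *: _]scalerA.
by rewrite by0 scaler0 addr0 !scalerA !mulrA.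
Qed.

Lemma piS_surj (theta : pp1 RS) : exists phi, piS phi = theta.
Proof.
case eth: (repr theta) => [n m A B].
have [s1 [A' [S1 A'P]]] := common_denominator (fun t : 'I_n * 'I_m => A t.1 t.2).
have [s2 [B' [S2 B'P]]] := common_denominator (fun j => B 0 j).
exists (\pi_(pp1 R) (PPF (\matrix_(i, j) (s2 * A' (i, j))) (\row_j (s1 * B' j)))).
have [t t1] : exists t : RS, t * loc (s1 * s2) = 1 by apply/loc_inverse/rpredM.
rewrite /piS pp1_map_pi; apply: pp1_psol_eq => M x; rewrite psol_pi /psol eth.
have lhs (y : 'I_n -> M) j : \sum_i loc (s2 * A' (i, j)) *: y i =
    loc (s1 * s2) *: \sum_i A i j *: y i.
  rewrite scaler_sumr; apply: eq_bigr => i _; rewrite scalerA; congr (_ *: _).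
  by rewrite !rmorphM /= -(A'P (i, j)) /=; ring.
have rhs j : loc (s1 * B' j) *: x = loc (s1 * s2) *: (B 0 j *: x).
  by rewrite scalerA !rmorphM /= -B'P; congr (_ *: _); ring.
split=> -[y yP]; exists y => j; have := yP j; rewrite /= !mxE.
  under eq_bigr do rewrite !mxE.
  by rewrite lhs rhs => /(congr1 ( *:%R t)); rewrite ![t *: _]scalerA t1 !scale1r.
by move=> e; under eq_bigr do rewrite !mxE; rewrite lhs rhs e.
Qed.

End LocalisationSR.

Theorem proposition6p1 (R : idomainType)
    (bezR : bezout_domain R) (nfR : ~ GRing.field_axiom R) :
  [/\ (forall phi psi : pp1 R,
         piS (phi `&` psi)%O = (piS phi `&` piS psi)%O),
      (forall phi psi : pp1 R,
         piS (phi `|` psi)%O = (piS phi `|` piS psi)%O),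
      (forall theta : pp1 (localisation (@SR R)),
         exists phi : pp1 R, piS phi = theta)
    & forall phi psi : pp1 R,
        piS phi = piS psi <->
        breadth0 (phi `&` psi)%O (phi `|` psi)%O].
Proof.
have piSI (phi psi : pp1 R) : piS (phi `&` psi)%O = (piS phi `&` piS psi)%O.
  exact: pp1_map_meet.
have piSU (phi psi : pp1 R) : piS (phi `|` psi)%O = (piS phi `|` piS psi)%O.
  exact: pp1_map_join.
split=> // [|phi psi]; first exact: piS_surj.
have leIU : (phi `&` psi <= phi `|` psi)%O by rewrite (le_trans (leIl _ _)) ?leUl.
split=> [e|[n [c [c0 cn cP]]]].
  have /(piS_le bezR)[s [Ss le]] : (piS (phi `|` psi) <= piS (phi `&` psi))%O.
    by rewrite piSI piSU e joinxx meetxx.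
  apply: (breadth0_sub (pp1_modular bezR) (lexx _) leIU le).
  by apply: (breadth0_colon bezR); apply/asboolP.
have cle i : (i <= n)%N -> (piS (c i) <= piS (c 0%N))%O.
  elim: i => [//|i IH] lt; apply: le_trans (IH (ltnW lt)).
  have [le tot] := cP i lt; apply/(piS_le bezR).
  have [s [Ss les]] := interval_total_colon bezR nfR tot le.
  by exists s; split=> //; apply/asboolP.
have := cle n (leqnn n); rewrite cn c0 piSU piSI leUx !lexI.
move=> /andP[/andP[_ le] /andP[ge _]].
by apply/le_anti/andP.
Qed.
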